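(* Consider the Stochastic Push-Pull iteration described in the context, under Assumptions (Graphs), (Weights), (Noise) and (Smoothness) stated there. Suppose that $$\frac{\max\{M_1,\tilde M_2,M_1\tilde M_2\}}{n(\pi_R^{\mathrm T}\pi_C)^2}\le c_0,$$ where $c_0$ is a constant that does not depend on $n$. Then linear speedup is achieved: there are a constant $c_1$ depending only on $c_0$ and an integer $T_0$ (which may depend on $n$, the weight matrices and the problem data) such that for every $T\ge T_0$ there is a constant stepsize $\gamma\ge0$ for which $$\frac1{T+1}\sum_{t=0}^T\mathbb E\|\nabla f(\hat x^{(t)})\|^2\le c_1\left(\frac{\Delta_f\sigma^2L}{n(T+1)}\right)^{\frac12}.$$
   Context: **Graphs and weights.** Let $\mathcal N=\{1,\dots,n\}$ and let $\mathbf 1\in\mathbb R^n$ be the all-ones vector. For a nonnegative matrix $W=[w_{ij}]\in\mathbb R^{n\times n}$, the induced directed graph $\mathcal G_W$ on $\mathcal N$ has edge $(i,j)$ (from $i$ to $j$) iff $w_{ji}>0$; $\mathcal R_W$ is the set of roots of all possible spanning trees of $\mathcal G_W$ (directed trees containing a directed path from the root to every node). For a nonnegative row-stochastic matrix $A$, a root eigenvector of $A$ is a vector $\pi_A\ge0$ with $\pi_A^{\mathrm T}A=\pi_A^{\mathrm T}$, $\|\pi_A\|_1=1$ and $\pi_A(i)=0$ for all $i\notin\mathcal R_A$. A nonnegative row-stochastic $A$ is exponentially decaying if there exist $\alpha\in(0,1)$, an integer $m>0$ and a root eigenvector $\pi_A$ such that $\|A^t-\mathbf 1\pi_A^{\mathrm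 T}\|_2\le\alpha^t$ for all $t\ge m$. Let $R,C\in\mathbb R^{n\times n}$ be nonnegative. (Graphs) $\mathcal G_R$ and $\mathcal G_{C^{\mathrm T}}$ each contain at least one spanning tree, and there is a pair of spanning trees (one in $\mathcal G_R$, one in $\mathcal G_{C^{\mathrm T}}$) sharing a common root; i.e. $\mathcal R_R\cap\mathcal R_{C^{\mathrm T}}\ne\emptyset$. (Weights) $R$ is row-stochastic ($R\mathbf 1=\mathbf 1$), $C$ is column-stochastic ($C^{\mathrm T}\mathbf 1=\mathbf 1$), and $R$ and $C^{\mathrm T}$ are exponentially decaying. Under these assumptions $R$ and $C^{\mathrm T}$ have unique root eigenvectors, denoted $\pi_R$ and $\pi_C$, and $\pi_R^{\mathrm T}\pi_C>0$. **Constants.** $M_1=\|\pi_R^{\mathrm T}C\|_2^2+\sum_{t\ge1}\|\pi_R^{\mathrm T}(C^{t+1}-C^t)\|_2^2$ and $M_2=\sum_{t\ge1}t\|\pi_R^{\mathrm T}(C^{t+1}-C^t)\|_2$ (both finite). $\tilde M_2=0$ if $\mathcal G_R$ and $\mathcal G_{C^{\mathrm T}}$ are (apart from the self-loop at the root) spanning trees with a common root and $R,C$ have only entries $0$ and $1$; otherwise $\tilde M_2=M_2$. **Problem and algorithm.** $f=\frac1n\sum_{i=1}^nf_i$ with $f_i:\mathbb R^p\to\mathbb R$. (Noise) Node $i$ can query $g_i(x,\xi_i)$ with $\xi_i\sim\mathcal D_i$ independent across $i$, and for some $\sigma^2>0$: $\mathbb E[g_i(x,\xi_i)\mid x]=\nabla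 f_i(x)$ and $\mathbb E[\|g_i(x,\xi_i)-\nabla f_i(x)\|^2\mid x]\le\sigma^2$. (Smoothness) Each $f_i$ is lower bounded and $\|\nabla f_i(x)-\nabla f_i(x')\|\le L\|x-x'\|$ for all $x,x'$ (with $L>0$). Write $f^*=\min_xf(x)$. Stochastic Push-Pull (S-PP) with stepsize $\gamma$: all nodes start at the same $x^{(0)}\in\mathbb R^p$; $X^{(t)}\in\mathbb R^{n\times p}$ has rows $(x_i^{(t)})^{\mathrm T}$, $Y^{(t)}\in\mathbb R^{n\times p}$ has rows $(y_i^{(t)})^{\mathrm T}$, $G^{(t)}$ has rows $g_i(x_i^{(t)},\xi_i^{(t)})^{\mathrm T}$, where the samples $\xi_i^{(t)}\sim\mathcal D_i$ are drawn independently over $i$ and $t$; $X^{(0)}=\mathbf 1(x^{(0)})^{\mathrm T}$, $Y^{(0)}=G^{(0)}$, and $$X^{(t+1)}=RX^{(t)}-\gamma RY^{(t)},\qquad Y^{(t+1)}=C\,(Y^{(t)}+G^{(t+1)}-G^{(t)}).$$ Put $\hat x^{(t)}=\pi_R^{\mathrm T}X^{(t)}$ (identified with a vector of $\mathbb R^p$) and $\Delta_f=f(x^{(0)})-f^*$. *)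

(* Defs.v *)
From HB Require Import structures.
From mathcomp Require Import all_boot all_order all_algebra.
From mathcomp Require Import all_classical all_reals all_analysis.
Set Implicit Arguments.
Unset Strict Implicit.
Unset Printing Implicit Defensive.
Import Order.TTheory GRing.Theory Num.Theory.
Import numFieldNormedType.Exports.
Local Open Scope classical_set_scope.
Local Open Scope ring_scope.

(* Euclidean norm of a row or column vector.  The library norm on matrices is
   the sup norm. *)
Definition enorm (K : realType) (m k : nat) (v : 'M[K]_(m, k)) : K :=
  Num.sqrt (\sum_i \sum_j v i j ^+ 2).

(* The matrix norm ||A||_2 induced by the Euclidean norm; it differs from
   [enorm A] unless A is a row or a column. *)
Definition opnorm2 (K : realType) (m k : nat) (A : 'M[K]_(m, k)) : K :=
  sup [set enorm (A *m v) | v in [set v : 'cV[K]_k | enorm v <= 1]].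

Definition grad (K : realType) (p : nat) (f : 'rV[K]_p -> K)
    (x : 'rV[K]_p) : 'rV[K]_p :=
  \row_j 'D_(delta_mx 0 j) f x.

Definition one (K : realType) (n : nat) : 'cV[K]_n := const_mx 1.
Arguments one {K n}.

Section Graphs.
Context (K : realType) (n : nat).
Implicit Types (W A R C : 'M[K]_n) (pi : 'cV[K]_n) (e : rel 'I_n).

Definition edge W : rel 'I_n := fun i j => 0 < W j i.

Definition directed_tree e (r : 'I_n) : Prop :=
  [/\ forall i, ~~ e i r,
      forall j, j != r -> #|[set i | e i j]%SET| = 1%N
    & forall j, connect e r j].

Definition spanning_tree W e (r : 'I_n) : Prop :=
  subrel e (edge W) /\ directed_tree e r.

Definition is_root W (r : 'I_n) : Prop := exists e, spanning_tree W e r.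

Definition nonneg_mx (m k : nat) (W : 'M[K]_(m, k)) : Prop :=
  forall i j, 0 <= W i j.

Definition row_stochastic A : Prop := A *m one = one.

Definition root_eigenvector A pi : Prop :=
  [/\ nonneg_mx pi,
      pi^T *m A = pi^T,
      \sum_i `|pi i 0| = 1
    & forall i, ~ is_root A i -> pi i 0 = 0].

Definition exponentially_decaying A : Prop :=
  exists (alpha : K) (m : nat) (pi : 'cV[K]_n),
    [/\ 0 < alpha < 1, (0 < m)%N, root_eigenvector A pi
      & forall t, (m <= t)%N ->
          opnorm2 (A ^+ t - one *m pi^T) <= alpha ^+ t].

Definition graphs_assumption R C : Prop :=
  exists r, is_root R r /\ is_root C^T r.

Definition weights_assumption R C : Prop :=
  [/\ nonneg_mx R /\ nonneg_mx C, row_stochastic R, row_stochastic C^T,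
      exponentially_decaying R & exponentially_decaying C^T].

Definition zero_one_mx W : Prop := forall i j, W i j = 0 \/ W i j = 1.

Definition edge_noloop W (r : 'I_n) : rel 'I_n :=
  fun i j => edge W i j && ~~ ((i == r) && (j == r)).

Definition common_root_trees R C : Prop :=
  (exists r, directed_tree (edge_noloop R r) r /\
             directed_tree (edge_noloop C^T r) r) /\
  zero_one_mx R /\ zero_one_mx C.

Local Open Scope ereal_scope.

Definition M1 (piR : 'cV[K]_n) (C : 'M[K]_n) : \bar K :=
  (enorm (piR^T *m C) ^+ 2)%:E +
  \sum_(1 <= t <oo) (enorm (piR^T *m (C ^+ t.+1 - C ^+ t)) ^+ 2)%:E.

Definition M2 (piR : 'cV[K]_n) (C : 'M[K]_n) : \bar K :=
  \sum_(1 <= t <oo) (t%:R * enorm (piR^T *m (C ^+ t.+1 - C ^+ t)))%:E.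

Definition M2tilde (R : 'M[K]_n) (piR : 'cV[K]_n) (C : 'M[K]_n) : \bar K :=
  if `[< common_root_trees R C >] then 0 else M2 piR C.

End Graphs.

Definition favg (K : realType) (n p : nat) (f : 'I_n -> 'rV[K]_p -> K)
    (x : 'rV[K]_p) : K :=
  n%:R^-1 * \sum_i f i x.

Definition smoothness_assumption (K : realType) (n p : nat)
    (f : 'I_n -> 'rV[K]_p -> K) (L : K) : Prop :=
  [/\ 0 < L,
      forall i, exists b, forall x, b <= f i x,
      forall i x, differentiable (f i) x
    & forall i x y, enorm (grad (f i) x - grad (f i) y) <= L * enorm (x - y)].

Definition independent_family (K : realType) (d : measure_display)
    (Omega : measurableType d) (P : probability Omega K)
    (I : choiceType) (dE : I -> measure_display)
    (E : forall k, measurableType (dE k)) (X : forall k, Omega -> E k) : Prop :=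
  forall (s : seq I) (A : forall k, set (E k)),
    uniq s -> (forall k, k \in s -> measurable (A k)) ->
    P (\bigcap_(k in [set` s]) (X k @^-1` A k)) =
    (\prod_(k <- s) P (X k @^-1` A k))%E.

Section Sampling.
Context (K : realType) (n p : nat).
Context (dXi : 'I_n -> measure_display)
  (Xi : forall i, measurableType (dXi i)).
Implicit Type g : forall i, 'rV[K]_p -> Xi i -> 'rV[K]_p.

(* Joint measurability in (x, xi_i); 'rV[K]_p carries no library
   sigma-algebra, so x ranges over p.-tuple K, whose sigma-algebra is the
   product (= Borel) one. *)
Definition jointly_measurable g : Prop :=
  forall i (j : 'I_p),
    measurable_fun [set: (p.-tuple K * Xi i)%type]
      (fun z => g i (\row_k tnth z.1 k) z.2 0 j).

(* The law of xi_i does not depend on x, so the expectations given x are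
   integrals against D_i with x fixed. *)
Definition noise_assumption (D : forall i, probability (Xi i) K) g
    (f : 'I_n -> 'rV[K]_p -> K) (sigma : K) : Prop :=
  [/\ 0 < sigma ^+ 2,
      jointly_measurable g,
      forall i x j,
        (D i).-integrable setT (fun s => (g i x s 0 j)%:E) /\
        ('E_(D i)[fun s => (g i x s 0 j)%R])%E = (grad (f i) x 0 j)%:E
    & forall i x,
        ('E_(D i)[fun s => (enorm (g i x s - grad (f i) x) ^+ 2)%R]
          <= (sigma ^+ 2)%:E)%E].

Definition sampling (d : measure_display) (Omega : measurableType d)
    (P : probability Omega K) (D : forall i, probability (Xi i) K)
    (xi : nat -> forall i, {RV P >-> Xi i}) : Prop :=
  (forall t i (A : set (Xi i)), measurable A ->
     distribution P (xi t i) A = D i A) /\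
  independent_family P (E := fun k : nat * 'I_n => Xi k.2)
    (fun k => xi k.1 k.2).

Definition stoch_grad g (s : forall i, Xi i) (X : 'M[K]_(n, p)) :
    'M[K]_(n, p) :=
  \matrix_(i, j) g i (row i X) (s i) 0 j.

(* The pair (X^(t), Y^(t)) along the sample path s. *)
Fixpoint spp (R C : 'M[K]_n) (gamma : K) g (x0 : 'rV[K]_p)
    (s : nat -> forall i, Xi i) (t : nat) : 'M[K]_(n, p) * 'M[K]_(n, p) :=
  match t with
  | 0 => let X := one *m x0 in (X, stoch_grad g (s 0%N) X)
  | t'.+1 =>
      let (X, Y) := spp R C gamma g x0 s t' in
      let X' := R *m X - gamma *: (R *m Y) in
      (X', C *m (Y + stoch_grad g (s t'.+1) X' - stoch_grad g (s t') X))
  end.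

Definition xhat (piR : 'cV[K]_n) (R C : 'M[K]_n) (gamma : K) g
    (x0 : 'rV[K]_p) (s : nat -> forall i, Xi i) (t : nat) : 'rV[K]_p :=
  piR^T *m (spp R C gamma g x0 s t).1.

End Sampling.

(* Main.v *)
Require Import Defs.
From HB Require Import structures.
From mathcomp Require Import all_boot all_order all_algebra.
From mathcomp Require Import all_classical all_reals all_analysis.
From mathcomp Require Import measurable_realfun.
From mathcomp Require Import ring lra.
Import Order.TTheory GRing.Theory Num.Theory.
Import numFieldNormedType.Exports.
Local Open Scope classical_set_scope.
Local Open Scope ring_scope.
Set Implicit Arguments.
Unset Strict Implicit.
Unset Printing Implicit Defensive.

(** Since T0 may depend on all the data, only the terms of leading order in the
stepsize gamma matter. Put S_t = Y_t - G_t, so that 1^T S_t = 0 and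
S_(t+1) = C S_t + (C - I) G_(t+1), and eta = pi_R^T pi_C > 0. Because the fixed
vectors of C are the multiples of pi_C, there is u with
u (I - C) = pi_R^T - eta 1^T, and the corrected average
w_(t+1) = pi_R^T X_(t+1) - gamma u C S_t satisfies
w_(t+2) = w_(t+1) - gamma eta 1^T G_(t+1): all the delays of the network are
absorbed in the correction. Hence the descent lemma along w only sees the noise
1^T (G - grad F(X)), whose variance is at most n sigma^2 by independence, so
that the leading noise term is L gamma^2 eta^2 n sigma^2. Exponential decay of
R and C gives E|X_(t+1) - 1 w_(t+1)|^2 = O(gamma^2), a contribution of higher
order, and eta cancels when
gamma = (Delta / (L n eta^2 sigma^2 (T + 1)))^(1/2). *)

(** * Frobenius inner product and exponential decay *)

(** The estimate of X_(t+1) - 1 w_(t+1) is conditional: it needs a bound [B] on E|G_s|^2 for all s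
    <= t. The gradients being unbounded, such a bound comes from the function gap at the corrected
    averages, which the descent inequality controls only through that same deviation. The circle is
    closed by an induction on t up to the horizon T, with [B] fixed beforehand and free of gamma.
    Conditional expectations are replaced by Fubini. For each sample (t, i), the probability space
    is given the sigma-algebra generated by all the other samples. It contains the earlier ones and
    also those of the other nodes at time t, so a single orthogonality statement removes both the
    inner products in the descent inequality and the cross terms between nodes. The average w_(t+1)
    involves samples up to time t only, hence the noise of G_(t+1) is still fresh for it. *)

Section Frobenius.
Context {K : realType}.

(** Lagrange's identity: the double sum of the squares of [a i * b j - a j * b i] is twice the gap
    between the two sides. *)
Lemma sum_cauchy_schwarz (I : finType) (a b : I -> K) :
  (\sum_i a i * b i) ^+ 2 <= (\sum_i a i ^+ 2) * (\sum_i b i ^+ 2).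
Proof.
have : 0 <= \sum_i \sum_j (a i * b j - a j * b i) ^+ 2.
  by apply: sumr_ge0 => i _; apply: sumr_ge0 => j _; apply: sqr_ge0.
under eq_bigr do under eq_bigr do rewrite sqrrB.
have e1 : \sum_i \sum_j (a i * b j) ^+ 2 =
    (\sum_i a i ^+ 2) * (\sum_i b i ^+ 2).
  by rewrite big_distrlr/=; under eq_bigr do under eq_bigr do rewrite exprMn.
have e2 : \sum_i \sum_j (a j * b i) ^+ 2 =
    (\sum_i a i ^+ 2) * (\sum_i b i ^+ 2).
  by rewrite exchange_big.
have e3 : \sum_i \sum_j (a i * b j * (a j * b i)) = (\sum_i a i * b i) ^+ 2.
  rewrite expr2 big_distrlr/=.
  by apply: eq_bigr => i _; apply: eq_bigr => j _; ring.
under eq_bigr do rewrite big_split/= sumrB.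
rewrite big_split/= sumrB e1 e2.
have -> : \sum_i \sum_j (a i * b j * (a j * b i) *+ 2) =
    (\sum_i a i * b i) ^+ 2 *+ 2.
  by rewrite -e3 -sumrMnl; apply: eq_bigr => i _; rewrite sumrMnl.
lra.
Qed.

Definition dot (m k : nat) (X Y : 'M[K]_(m, k)) : K :=
  \sum_i \sum_j X i j * Y i j.

Definition sq (m k : nat) (X : 'M[K]_(m, k)) : K := dot X X.

Section Dot.
Context {m k : nat}.
Implicit Types X Y Z : 'M[K]_(m, k).

Lemma dotC X Y : dot X Y = dot Y X.
Proof. by apply: eq_bigr => i _; apply: eq_bigr => j _; rewrite mulrC. Qed.

Lemma dotDl X Y Z : dot (X + Y) Z = dot X Z + dot Y Z.
Proof.
rewrite /dot -big_split; apply: eq_bigr => i _; rewrite -big_split.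
by apply: eq_bigr => j _; rewrite mxE mulrDl.
Qed.

Lemma dotZl (a : K) X Z : dot (a *: X) Z = a * dot X Z.
Proof.
rewrite /dot mulr_sumr; apply: eq_bigr => i _; rewrite mulr_sumr.
by apply: eq_bigr => j _; rewrite mxE mulrA.
Qed.

Lemma dotNl X Z : dot (- X) Z = - dot X Z.
Proof. by rewrite -scaleN1r dotZl mulN1r. Qed.

Lemma dotDr X Y Z : dot Z (X + Y) = dot Z X + dot Z Y.
Proof. by rewrite dotC dotDl !(dotC Z). Qed.

Lemma dotZr (a : K) X Z : dot Z (a *: X) = a * dot Z X.
Proof. by rewrite dotC dotZl dotC. Qed.

Lemma dotNr X Z : dot Z (- X) = - dot Z X.
Proof. by rewrite dotC dotNl dotC. Qed.

Lemma dot0r X : dot X 0 = 0.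
Proof. by rewrite -(scale0r X) dotZr mul0r. Qed.

Lemma sqE X : sq X = \sum_i \sum_j X i j ^+ 2.
Proof. by []. Qed.

Lemma sq_ge0 X : 0 <= sq X.
Proof.
by apply: sumr_ge0 => i _; apply: sumr_ge0 => j _; rewrite -expr2 sqr_ge0.
Qed.

Lemma entry_sq_le X i j : X i j ^+ 2 <= sq X.
Proof.
rewrite sqE (bigD1 i)//= (bigD1 j)//= -addrA lerDl.
by apply: addr_ge0; apply: sumr_ge0 => *; rewrite ?sqr_ge0//;
  apply: sumr_ge0 => *; rewrite sqr_ge0.
Qed.

Lemma sq_eq0 X : sq X <= 0 -> X = 0.
Proof.
move=> X0; apply/matrixP => i j; rewrite mxE; apply/eqP.
by rewrite -sqrf_eq0 eq_le sqr_ge0 andbT (le_trans (entry_sq_le X i j)).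
Qed.

Lemma sqZ (a : K) X : sq (a *: X) = a ^+ 2 * sq X.
Proof. by rewrite /sq dotZl dotZr mulrA. Qed.

Lemma sqN X : sq (- X) = sq X.
Proof. by rewrite /sq dotNl dotNr opprK. Qed.

Lemma sq0 : sq (0 : 'M[K]_(m, k)) = 0.
Proof. exact: dot0r. Qed.

Lemma sqD X Y : sq (X + Y) = sq X + 2 * dot X Y + sq Y.
Proof. by rewrite /sq dotDl !dotDr (dotC Y X); ring. Qed.

Lemma sqD_le X Y : sq (X + Y) <= 2 * sq X + 2 * sq Y.
Proof.
have := sq_ge0 (X - Y); rewrite !sqD sqN dotNr; lra.
Qed.

Lemma sqB_le X Y : sq (X - Y) <= 2 * sq X + 2 * sq Y.
Proof. by rewrite -(sqN Y) sqD_le. Qed.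

Lemma sq_le_shift X Y : sq X <= 2 * sq Y + 2 * sq (X - Y).
Proof. by rewrite -[X in sq X <= _](subrKC Y); apply: sqD_le. Qed.

(** Completion of the square in [(a / 2) *: X + Y]. The descent step takes a = n, so that the
    gradient error costs a quarter of the decrease. *)
Lemma dot_le_sq X Y (a : K) : 0 < a -> - dot X Y <= a / 4 * sq X + a^-1 * sq Y.
Proof.
move=> a0; have := sq_ge0 ((a / 2) *: X + Y).
rewrite sqD !sqZ dotZl => h.
have -> : a / 4 * sq X + a^-1 * sq Y =
   a^-1 * ((a / 2) ^+ 2 * sq X + sq Y) by field; rewrite gt_eqF.
rewrite mulrC ler_pdivlMr//; lra.
Qed.

Lemma enorm_sq X : enorm X ^+ 2 = sq X.
Proof. by rewrite sqr_sqrtr// sq_ge0. Qed.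

Lemma dot_cauchy_schwarz X Y : dot X Y ^+ 2 <= sq X * sq Y.
Proof.
rewrite !sqE /dot !pair_bigA; exact: (sum_cauchy_schwarz (fun p => X p.1 p.2)
  (fun p => Y p.1 p.2)).
Qed.

Lemma dot_le_enorm X Y : dot X Y <= enorm X * enorm Y.
Proof.
have h : 0 <= enorm X * enorm Y by rewrite mulr_ge0 ?sqrtr_ge0.
rewrite (le_trans (ler_norm _))//.
by rewrite -(ger0_norm h) -ler_sqr ?nnegrE// !real_normK ?num_real//
  exprMn !enorm_sq dot_cauchy_schwarz.
Qed.

End Dot.

Lemma sq_row (m k : nat) (X : 'M[K]_(m, k)) : sq X = \sum_i sq (row i X).
Proof.
rewrite sqE; apply: eq_bigr => i _; rewrite sqE big_ord1.
by apply: eq_bigr => j _; rewrite mxE.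
Qed.

Lemma sq_mulmx (m k l : nat) (A : 'M[K]_(m, k)) (B : 'M[K]_(k, l)) :
  sq (A *m B) <= sq A * sq B.
Proof.
rewrite !sqE mulr_suml; apply: ler_sum => i _.
rewrite [X in _ * X]exchange_big mulr_sumr/=.
by apply: ler_sum => j _; rewrite mxE sum_cauchy_schwarz.
Qed.

Lemma sq_tr (m k : nat) (A : 'M[K]_(m, k)) : sq A^T = sq A.
Proof.
rewrite !sqE exchange_big; apply: eq_bigr => i _; apply: eq_bigr => j _.
by rewrite mxE.
Qed.

Lemma sq_one (n : nat) : sq (@Defs.one K n) = n%:R.
Proof.
rewrite sqE; under eq_bigr do rewrite big_ord1 mxE expr1n.
by rewrite sumr_const card_ord.
Qed.

End Frobenius.

(** * Decay of powers, uniqueness and positivity of root eigenvectors *)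

Section Decay.
Context {K : realType}.

(** Replaces passages to the limit: applied to a squared norm that is free of t, it yields an
    equality of matrices. *)
Lemma geometric_vanish (a b th : K) : 0 <= th < 1 ->
  (forall t : nat, a <= b * th ^+ t) -> a <= 0.
Proof.
move=> /andP[th0 th1] h.
have c : b * th ^+ t @[t --> \oo] --> b * 0.
  by apply: cvgMr; apply: cvg_expr; rewrite ger0_norm.
rewrite mulr0 in c.
rewrite -(cvg_lim _ c)//; apply: limr_ge; first by apply/cvg_ex; exists 0.
by near=> t; apply: h.
Unshelve. all: by end_near. Qed.

Lemma enorm_mulmx_le_opnorm2 (m k : nat) (A : 'M[K]_(m, k)) (v : 'cV[K]_k) :
  enorm v <= 1 -> enorm (A *m v) <= opnorm2 A.
Proof.
move=> v1; apply: ub_le_sup; last by exists v.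
(* An element lies below [sup] only if the set is bounded above; the Frobenius norm is such a
   bound. *)
exists (enorm A) => _ [w /= w1 <-].
rewrite -ler_sqr ?nnegrE ?sqrtr_ge0// !enorm_sq (le_trans (sq_mulmx _ _))//.
rewrite -[leRHS]mulr1 ler_wpM2l ?sq_ge0// -enorm_sq.
by rewrite expr_le1 ?sqrtr_ge0.
Qed.

Lemma opnorm2_ge0 (m k : nat) (A : 'M[K]_(m, k)) : 0 <= opnorm2 A.
Proof.
apply: le_trans (enorm_mulmx_le_opnorm2 A (v := 0) _); first exact: sqrtr_ge0.
by rewrite /enorm -sqE sq0 sqrtr0.
Qed.

Lemma entry_le_opnorm2 (m k : nat) (A : 'M[K]_(m, k)) i j :
  `|A i j| <= opnorm2 A.
Proof.
pose v : 'cV[K]_k := delta_mx j 0.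
have v1 : sq v = 1.
  rewrite sqE (bigD1 j)//= big_ord1 mxE !eqxx expr1n big1 ?addr0// => l lj.
  by rewrite big_ord1 mxE (negbTE lj) expr0n.
have ev1 : enorm v <= 1 by rewrite /enorm -sqE v1 sqrtr1.
apply: le_trans (enorm_mulmx_le_opnorm2 A ev1).
rewrite -ler_sqr ?nnegrE ?sqrtr_ge0// real_normK ?num_real// enorm_sq.
by apply: le_trans (entry_sq_le _ i 0); rewrite -colE mxE.
Qed.

Lemma sq_le_opnorm2 (m k : nat) (A : 'M[K]_(m, k)) :
  sq A <= (m * k)%:R * opnorm2 A ^+ 2.
Proof.
rewrite sqE (@le_trans _ _ (\sum_(i < m) \sum_(j < k) opnorm2 A ^+ 2))//.
  apply: ler_sum => i _; apply: ler_sum => j _.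
  have h := entry_le_opnorm2 A i j.
  by rewrite -real_normK ?num_real// ler_sqr ?nnegrE// (le_trans _ h).
by rewrite !sumr_const !card_ord -mulrnA mulr_natl mulnC.
Qed.

Lemma root_eigenvector_sum (n : nat) (A : 'M[K]_n) (pi : 'cV[K]_n) :
  root_eigenvector A pi -> pi^T *m Defs.one = 1%:M.
Proof.
move=> [pi0 _ s1 _]; apply/matrixP => i j; rewrite !ord1 !mxE -s1.
by apply: eq_bigr => l _; rewrite !mxE mulr1 ger0_norm.
Qed.

Lemma root_eigenvector_pow (n : nat) (A : 'M[K]_n) (pi : 'cV[K]_n) t :
  pi^T *m A = pi^T -> pi^T *m A ^+ t = pi^T.
Proof.
by move=> piA; elim: t => [|t IH]; rewrite ?expr0 ?mulmx1// exprS mulmxA piA.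
Qed.

(** Two adjustments of the hypothesis: the decay is made to hold from t = 0 on, at the price of
    [kap], and the eigenvector hidden in [exponentially_decaying] is identified with the given
    [pi]. *)
Lemma exponential_decay (n : nat) (A : 'M[K]_n) (pi : 'cV[K]_n) :
  root_eigenvector A pi -> exponentially_decaying A ->
  exists th kap : K, [/\ 0 < th < 1, 0 <= kap & forall t,
    sq (A ^+ t - Defs.one *m pi^T) <= kap * (th ^+ t) ^+ 2].
Proof.
move=> rpi [al [m [pi' [/andP[al0 al1] m0 rpi' dec]]]].
pose J : 'M[K]_n := Defs.one *m pi'^T.
(* The first summand converts the operator norm into the Frobenius norm for t >= m; the finite sum
   covers the finitely many t < m. *)
pose kap := (n * n)%:R + \sum_(s < m) sq (A ^+ s - J) / (al ^+ s) ^+ 2.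
have kap1 s : 0 <= sq (A ^+ s - J) / (al ^+ s) ^+ 2.
  by rewrite mulr_ge0 ?sq_ge0// invr_ge0 sqr_ge0.
have kap0 : 0 <= kap by apply: addr_ge0 => //; apply: sumr_ge0 => s _.
have bnd t : sq (A ^+ t - J) <= kap * (al ^+ t) ^+ 2.
  have alt : 0 < (al ^+ t) ^+ 2 by rewrite !exprn_gt0.
  have [mt|tm] := leqP m t.
    apply: le_trans (sq_le_opnorm2 _) _.
    apply: (@le_trans _ _ ((n * n)%:R * (al ^+ t) ^+ 2)).
      rewrite ler_wpM2l// ler_sqr ?nnegrE ?opnorm2_ge0 ?dec//.
      by rewrite exprn_ge0 ?(ltW al0).
    by rewrite ler_pM2r// lerDl; apply: sumr_ge0.
  rewrite -ler_pdivrMr// /kap (bigD1 (Ordinal tm))//= addrCA lerDl.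
  by apply: addr_ge0 => //; apply: sumr_ge0 => s _.
(* Since [pi] is fixed by [A] and sums to 1, pi^T (A^t - J) is the constant pi^T - pi'^T; being
   geometrically small, it vanishes. *)
have piE : pi'^T = pi^T.
  apply/eqP; rewrite eq_sym -subr_eq0; apply/eqP; apply: sq_eq0.
  apply: (@geometric_vanish _ (sq pi^T * kap) (al ^+ 2)).
    by rewrite exprn_ge0 ?(ltW al0)//= expr_lt1// ltW.
  move=> t; have -> : pi^T - pi'^T = pi^T *m (A ^+ t - J).
    rewrite mulmxBr root_eigenvector_pow; last by case: rpi.
    by rewrite mulmxA (root_eigenvector_sum rpi) mul1mx.
  apply: le_trans (sq_mulmx _ _) _.
  by rewrite -mulrA ler_wpM2l ?sq_ge0// exprAC bnd.
exists al, kap; split; [by rewrite al0|exact: kap0|].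
by move=> t; rewrite -piE; apply: bnd.
Qed.

(** Positivity travels up the tree: an edge from i to j means A j i > 0, so stationarity passes mass
    from j to its parent i. Some entry is positive because of the normalisation, and the path from
    the root to it is climbed back. *)
Lemma root_pos (n : nat) (A : 'M[K]_n) (pi : 'cV[K]_n) (r : 'I_n) :
  nonneg_mx A -> root_eigenvector A pi -> is_root A r -> 0 < pi r 0.
Proof.
move=> A0 [pi0 piA s1 _] [e [sub [_ _ conn]]].
have step i j : e i j -> 0 < pi j 0 -> 0 < pi i 0.
  move=> /sub /= eij pj.
  have -> : pi i 0 = (pi^T *m A) 0 i by rewrite piA mxE.
  rewrite mxE (bigD1 j)//= mxE ltr_wpDr ?mulr_gt0//.
  by apply: sumr_ge0 => k _; rewrite mxE mulr_ge0.
have [j pj] : exists j, 0 < pi j 0.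
  apply: contrapT => /forallNP h; move: s1; rewrite big1 => [/eqP|i _].
    by rewrite eq_sym oner_eq0.
  by apply/eqP; rewrite normr_eq0 eq_le pi0 andbT leNgt; apply/negP/h.
have /connectP[p pth lst] := conn j.
elim: p r pth lst {conn} => [|k p IH] r /=; first by move=> _ <-.
by move=> /andP[erk pth] lst; apply: step erk (IH _ pth lst).
Qed.

(** Solvability is tested on the cokernel of 1 - C instead of by summing a Neumann series. The
    columns of the cokernel are fixed by [C], hence by the limit of its powers; so they are
    multiples of [pi], and [v] kills them. *)
Lemma fixed_space_coker (n : nat) (C : 'M[K]_n) (pi : 'cV[K]_n) (th kap : K) :
  0 < th < 1 ->
  (forall t, sq (C ^+ t - pi *m Defs.one^T) <= kap * (th ^+ t) ^+ 2) ->
  forall v : 'rV[K]_n, v *m pi = 0 -> exists u, u *m (1%:M - C) = v.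
Proof.
move=> /andP[th0 th1] dec v vpi.
suff /submxP[u ->] : (v <= 1%:M - C)%MS by exists u.
rewrite submxE; set c := cokermx _.
have Cc : C *m c = c.
  by apply/eqP; rewrite eq_sym -subr_eq0 -{1}[c]mul1mx -mulmxBl mulmx_coker.
have Ctc t : C ^+ t *m c = c.
  by elim: t => [|t IH]; rewrite ?expr0 ?mul1mx// exprSr -mulmxA Cc.
have -> : c = pi *m (Defs.one^T *m c).
  apply/subr0_eq; apply: sq_eq0.
  apply: (@geometric_vanish _ (kap * sq c) (th ^+ 2)).
    by rewrite exprn_ge0 ?(ltW th0)//= expr_lt1// ltW.
  move=> t; rewrite -{1}(Ctc t) mulmxA -mulmxBl.
  apply: le_trans (sq_mulmx _ _) _.
  by rewrite mulrAC ler_wpM2r ?sq_ge0// exprAC dec.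
by rewrite (mulmxA v pi) vpi mul0mx eqxx.
Qed.

Lemma trmx_pow (n : nat) (A : 'M[K]_n) t : (A ^+ t)^T = A^T ^+ t.
Proof.
by elim: t => [|t IH]; rewrite ?expr0 ?trmx1// exprS trmx_mul IH exprSr.
Qed.

(** Convexity of the square for X + Y = th (X / th) + (1 - th) (Y / (1 - th)). The weight th is what
    lets the bound of [stable_filter_Ex] reproduce itself. *)
Lemma sqD_convex (m k : nat) (X Y : 'M[K]_(m, k)) (th : K) : 0 < th < 1 ->
  sq (X + Y) <= th^-1 * sq X + (1 - th)^-1 * sq Y.
Proof.
move=> /andP[th0 th1].
have := sq_ge0 ((1 - th) *: X - th *: Y).
rewrite !sqD sqN dotNr !sqZ dotZl dotZr => h.
have -> : th^-1 * sq X + (1 - th)^-1 * sq Y =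
    (th * (1 - th))^-1 * ((1 - th) * sq X + th * sq Y).
  by field; rewrite subr_eq0 !gt_eqF.
rewrite (mulrC (_^-1)) ler_pdivlMr ?mulr_gt0 ?subr_gt0//.
by nra.
Qed.

End Decay.

(** * Smooth functions *)

Section SmoothFunction.
Context {K : realType} {p : nat}.
Implicit Types (f : 'rV[K]_p -> K) (x y v : 'rV[K]_p).

Lemma derive_grad f x v : differentiable f x -> 'D_v f x = dot (grad f x) v.
Proof.
move=> df; rewrite deriveE// [v in LHS]row_sum_delta linear_sum/=.
rewrite /dot big_ord1; apply: eq_bigr => j _.
by rewrite linearZ/= mxE deriveE// mulrC.
Qed.

Section Descent.
Variables (f : 'rV[K]_p -> K) (L : K).
Hypothesis L0 : 0 < L.
Hypothesis df : forall x, differentiable f x.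
Hypothesis lipf : forall x y, enorm (grad f x - grad f y) <= L * enorm (x - y).

Lemma sq_grad_lipschitz x y :
  sq (grad f x - grad f y) <= L ^+ 2 * sq (x - y).
Proof.
rewrite -!enorm_sq -exprMn ler_sqr ?nnegrE ?sqrtr_ge0//.
by rewrite mulr_ge0 ?sqrtr_ge0// ltW.
Qed.

(** A single mean value point on the segment is used, not an integral along it; hence the constant L
    in place of L / 2. *)
Lemma descent x y : f y <= f x + dot (grad f x) (y - x) + L * sq (y - x).
Proof.
pose v := y - x; pose line (s : K) : 'rV[K]_p := x + s *: v.
have dline s : is_diff s line (fun h : K => h *: v).
  have -> : (fun h : K => h *: v) = 0 + *:%R^~ v.
    by apply/funext => h /=; rewrite fctE/= add0r.
  exact: is_diffD.
have dphi (s : K) : s \in `]0, 1[ ->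
    is_derive s (1 : K) (f \o line) (dot (grad f (line s)) v).
  move=> _; have dfl : differentiable (f \o line) s.
    exact: differentiable_comp.
  split; first exact: diff_derivable.
  rewrite deriveE// diff_comp//= diff_val scale1r.
  by rewrite -derive_grad// deriveE.
have cphi : {within `[0, 1], continuous (f \o line)}.
  apply: continuous_subspaceT => s; apply: differentiable_continuous.
  exact: differentiable_comp.
have [c] := MVT (@ltr01 K) dphi cphi.
rewrite in_itv/= => /andP[c0 c1].
rewrite /line scale1r scale0r addr0 subr0 mulr1 /v (addrC x) subrK -/v.
move/(canRL (subrK _)) => ->; rewrite addrC -addrA lerD2l -lerBlDl -dotNl -dotDl.
apply: le_trans (dot_le_enorm _ _) _.
apply: (@le_trans _ _ (L * enorm (c *: v) * enorm v)).
  rewrite ler_wpM2r ?sqrtr_ge0//; apply: le_trans (lipf _ _) _.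
  by rewrite (addrC x) addrK.
rewrite -mulrA ler_pM2l// -enorm_sq expr2 ler_wpM2r ?sqrtr_ge0//.
rewrite -ler_sqr ?nnegrE ?sqrtr_ge0// !enorm_sq sqZ.
by rewrite ler_piMl ?sq_ge0// expr_le1// ltW.
Qed.

(** A gradient step of length 1 / (2 L) lowers f by at least |grad f|^2 / (4 L), and f cannot go
    below [b]. *)
Lemma sq_grad_le b x : (forall y, b <= f y) -> sq (grad f x) <= 4 * L * (f x - b).
Proof.
move=> fb; have := descent x (x - (2 * L)^-1 *: grad f x).
rewrite (addrC x) addrK sqN sqZ dotNr dotZr -/(sq _) => h.
have := le_trans (fb _) h; rewrite -lerBlDl.
have -> : - ((2 * L)^-1 * sq (grad f x)) = - 2 * ((4 * L)^-1 * sq (grad f x)).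
  by field; rewrite gt_eqF.
have -> : L * ((2 * L)^-1 ^+ 2 * sq (grad f x)) = (4 * L)^-1 * sq (grad f x).
  by field; rewrite gt_eqF.
move=> h2; rewrite -ler_pdivrMl ?mulr_gt0//; lra.
Qed.

End Descent.
End SmoothFunction.

(** * The average objective and the stacked gradients *)

Section SmoothNetwork.
Context {K : realType} {n p : nat}.
Variables (f : 'I_n -> 'rV[K]_p -> K) (L : K).
Hypothesis n0 : (0 < n)%N.
Hypothesis smooth : smoothness_assumption f L.

Local Notation one := (@Defs.one K n).

Definition gradmx (X : 'M[K]_(n, p)) : 'M[K]_(n, p) :=
  \matrix_(i, j) grad (f i) (row i X) 0 j.

Lemma row_gradmx X i : row i (gradmx X) = grad (f i) (row i X).
Proof. by apply/rowP => j; rewrite !mxE. Qed.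

Lemma row_one (x : 'rV[K]_p) i : row i (one *m x) = x.
Proof. by apply/rowP => j; rewrite !mxE big_ord1 mxE mul1r. Qed.

Lemma sq_one_mul (x : 'rV[K]_p) : sq (one *m x) = n%:R * sq x.
Proof.
rewrite sq_row; under eq_bigr do rewrite row_one.
by rewrite sumr_const card_ord mulr_natl.
Qed.

Lemma sq_gradmx_lipschitz X Y : sq (gradmx X - gradmx Y) <= L ^+ 2 * sq (X - Y).
Proof.
rewrite !sq_row mulr_sumr; apply: ler_sum => i _.
have [L0 _ _ lip] := smooth.
by rewrite !linearB/= !row_gradmx; apply: sq_grad_lipschitz.
Qed.

Let nR0 : 0 < n%:R :> K. Proof. by rewrite ltr0n. Qed.

Lemma favgE : favg f = n%:R^-1 \*: \sum_(i < n) f i.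
Proof. by apply/funext => x; congr (_ * _); rewrite fct_sumE. Qed.

Lemma differentiable_favg x : differentiable (favg f) x.
Proof.
rewrite favgE; apply: differentiableZ; apply: differentiable_sum => i.
by case: smooth.
Qed.

Lemma grad_favg x :
  grad (favg f) x = n%:R^-1 *: (one^T *m gradmx (one *m x)).
Proof.
have [_ _ df _] := smooth.
apply/rowP => j; rewrite !mxE favgE deriveZ; last first.
  by apply: derivable_sum => i; apply: diff_derivable.
rewrite derive_sum; last by move=> i; apply: diff_derivable.
congr (_ * _); apply: eq_bigr => i _.
by rewrite !mxE mul1r row_one.
Qed.

(** Two factors n, one from summing the rows and one from replicating the point, cancel the square
    of 1 / n. *)
Lemma grad_favg_lipschitz x y :
  enorm (grad (favg f) x - grad (favg f) y) <= L * enorm (x - y).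
Proof.
have [L0 _ _ _] := smooth.
rewrite -ler_sqr ?nnegrE ?sqrtr_ge0//; last by rewrite mulr_ge0 ?sqrtr_ge0// ltW.
rewrite exprMn !enorm_sq !grad_favg -scalerBr -mulmxBr sqZ.
apply: (@le_trans _ _ (n%:R^-1 ^+ 2 *
    (n%:R * (L ^+ 2 * (n%:R * sq (x - y)))))).
  rewrite ler_wpM2l ?sqr_ge0//; apply: le_trans (sq_mulmx _ _) _.
  rewrite sq_tr sq_one ler_pM2l// -sq_one_mul mulmxBr.
  exact: sq_gradmx_lipschitz.
by rewrite le_eqVlt; apply/orP; left; apply/eqP; field; rewrite gt_eqF.
Qed.

Lemma descent_favg x y :
  favg f y <= favg f x + dot (grad (favg f) x) (y - x) + L * sq (y - x).
Proof.
have [L0 _ _ _] := smooth.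
by apply: descent => //; [exact: differentiable_favg|exact: grad_favg_lipschitz].
Qed.

Lemma sq_grad_favg_le b x : (forall y, b <= favg f y) ->
  sq (grad (favg f) x) <= 4 * L * (favg f x - b).
Proof.
have [L0 _ _ _] := smooth.
by apply: sq_grad_le => //; [exact: differentiable_favg|exact: grad_favg_lipschitz].
Qed.

(** The individual gradients need not vanish at a minimiser of the average; they are still
    controlled by its gap if the reference level [flb] is the mean of lower bounds of the f_i,
    possibly below the infimum of [favg f]. *)
Lemma sq_gradmx_one_le : exists flb : K,
  (forall x, flb <= favg f x) /\
  (forall x, sq (gradmx (one *m x)) <= 4 * L * n%:R * (favg f x - flb)).
Proof.
have [L0 /choice[b bP] df lip] := smooth.
exists (n%:R^-1 * \sum_i b i); split=> x.
  by rewrite /favg ler_pM2l ?invr_gt0//; apply: ler_sum => i _.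
rewrite sq_row /favg -mulrBr -sumrB mulrA mulfK ?gt_eqF// mulr_sumr.
apply: ler_sum => i _; rewrite row_gradmx row_one.
by apply: sq_grad_le => //; exact: bP.
Qed.

End SmoothNetwork.

(** * Independence and freezing *)

Section Freezing.
Context {K : realType} {d : measure_display} {Omega : measurableType d}.
Context {P : probability Omega K} {I : choiceType} {dE : I -> measure_display}.
Context {E : forall k, measurableType (dE k)}.
Variable X : forall k, {mfun Omega >-> E k}.
Hypothesis indep : independent_family P X.
Variable k0 : I.

(** Generators of the information carried by all samples but [k0], later ones included. A family
    over all indices, trivial outside [s], makes closure under intersection componentwise. *)
Definition cylinders : set (set Omega) :=
  [set B | exists (s : seq I) (A : forall k, set (E k)),
    [/\ k0 \notin s, forall k, measurable (A k),
        forall k, k \notin s -> A k = setT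
      & B = [set w | forall k, A k (X k w)]]].

Lemma finite_cylinderE (s : seq I) (A : forall k, set (E k)) :
  (forall k, k \notin s -> A k = setT) ->
  [set w | forall k, A k (X k w)] =
  \bigcap_(k in [set` undup s]) (X k @^-1` A k).
Proof.
move=> AT; apply/seteqP; split=> w /= h k; first by move=> _; apply: h.
have [ks|/AT ->//] := boolP (k \in s).
by apply: (h k); rewrite /= mem_undup.
Qed.

Lemma measurable_preimage_mfun k (A : set (E k)) :
  measurable A -> measurable (X k @^-1` A).
Proof. by move=> mA; rewrite -[X in measurable X]setTI; exact: measurable_funP. Qed.

Lemma cylinders_measurable : cylinders `<=` measurable.
Proof.
move=> _ [s [A [_ mA AT ->]]]; rewrite (finite_cylinderE AT).
rewrite bigcap_seq; apply: bigsetI_measurable => k _.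
exact: measurable_preimage_mfun.
Qed.

Lemma cylinders_setI : setI_closed cylinders.
Proof.
move=> _ _ [s [A [ks mA AT ->]]] [s' [A' [ks' mA' AT' ->]]].
exists (s ++ s'), (fun k => A k `&` A' k); split.
- by rewrite mem_cat negb_or ks.
- by move=> k; apply: measurableI.
- by move=> k; rewrite mem_cat negb_or => /andP[/AT-> /AT'->]; rewrite setTI.
- by apply/seteqP; split=> [w [h h'] k|w h]; split=> // k; case: (h k).
Qed.

Lemma preimage_cylinder k (A : set (E k)) :
  k != k0 -> measurable A -> cylinders (X k @^-1` A).
Proof.
move=> kk0 mA; exists [:: k], (dfwith (fun j => [set: E j]) k A); split.
- by rewrite inE eq_sym.
- move=> j; have [<-|jk] := eqVneq k j; first by rewrite dfwithin.
  by rewrite dfwithout.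
- by move=> j; rewrite inE => jk; rewrite dfwithout// eq_sym.
- apply/seteqP; split=> w /= h; last by have := h k; rewrite dfwithin.
  move=> j; have [<-|jk] := eqVneq k j; first by rewrite dfwithin.
  by rewrite dfwithout.
Qed.

(** Independence is used twice, with and without [k0] in the list; [dfwith] inserts the event of
    [k0] in the family. *)
Lemma cylinder_indep (B : set Omega) (A0 : set (E k0)) : cylinders B ->
  measurable A0 ->
  P (B `&` (X k0 @^-1` A0)) = (P B * P (X k0 @^-1` A0))%E.
Proof.
move=> [s [A [ks mA AT ->]]] mA0.
have ku : k0 \notin undup s by rewrite mem_undup.
have wk k : k \in undup s -> dfwith A k0 A0 k = A k.
  by move=> kin; rewrite dfwithout//; apply: contraNneq ku => ->.
have := indep (s := k0 :: undup s) (A := dfwith A k0 A0).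
rewrite /= ku undup_uniq big_cons dfwithin => /(_ isT) e.
have {e}: P (\bigcap_(k in [set` k0 :: undup s]) X k @^-1` dfwith A k0 A0 k) =
    (P (X k0 @^-1` A0) *
     \prod_(k <- undup s) P (X k @^-1` dfwith A k0 A0 k))%E.
  apply: e => k _; have [<-|k0k] := eqVneq k0 k; first by rewrite dfwithin.
  by rewrite dfwithout.
rewrite (finite_cylinderE AT) !bigcap_seq big_cons dfwithin.
rewrite (eq_big_seq (fun k => X k @^-1` A k)); last by move=> k /wk ->.
rewrite setIC => ->; rewrite muleC; congr (_ * _)%E.
rewrite -bigcap_seq indep ?undup_uniq//.
by apply: eq_big_seq => k /wk ->.
Qed.

Local Notation pastType := (g_sigma_algebraType cylinders).

(** The identity, seen as a random variable with values in Omega with the coarser sigma-algebra, so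
    that its law and its pairing with [X k0] make sense. *)
Definition to_past (w : Omega) : pastType := w.

Lemma measurable_to_past : measurable_fun setT to_past.
Proof.
move=> _ A mA; rewrite setTI.
by apply: (smallest_sub (@sigma_algebra_measurable _ Omega) cylinders_measurable).
Qed.

HB.instance Definition _ := isMeasurableFun.Build _ _ _ _ to_past
  measurable_to_past.

(** Both sides are finite measures in [B] that agree on the generating pi-system. [mscale] wants a
    real factor, hence [r0] and [rE]. *)
Lemma past_indep (B : set pastType) (A0 : set (E k0)) : measurable B ->
  measurable A0 ->
  P (B `&` (X k0 @^-1` A0)) = (P B * P (X k0 @^-1` A0))%E.
Proof.
move=> mB mA0; have mX := measurable_preimage_mfun mA0.
have r0 : 0 <= fine (P (X k0 @^-1` A0)) by rewrite fine_ge0.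
have rE : (fine (P (X k0 @^-1` A0)))%:E = P (X k0 @^-1` A0).
  by rewrite fineK ?fin_num_measure.
have setTc : cylinders setT.
  by exists [::], (fun=> setT); split=> //; apply/seteqP; split.
have := @g_sigma_algebra_measure_unique _ _ _ _ cylinders_measurable
  (fun _ => setT) (fun=> setTc) (bigcup_const _ _)
  (mrestr P mX) (mscale (NngNum r0) P) cylinders_setI.
move=> /(_ _ _ _ B) h; rewrite muleC -rE; apply: h => //.
- move=> A cA; transitivity (P A * P (X k0 @^-1` A0))%E.
    exact: cylinder_indep.
  by rewrite muleC; congr (_ * _)%E; exact: esym rE.
- by move=> _; rewrite /mrestr ltey_eq fin_num_measure//; apply: measurableI.
Qed.

Definition past_pair (w : Omega) : pastType * E k0 := (to_past w, X k0 w).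

Lemma measurable_past_pair : measurable_fun setT past_pair.
Proof. by apply: measurable_fun_pair => //; exact: measurable_to_past. Qed.

HB.instance Definition _ := isMeasurableFun.Build _ _ _ _ past_pair
  measurable_past_pair.

Let joint := distribution P past_pair.
Let past := distribution P to_past.

Section Law.
Variable D : probability (E k0) K.
Hypothesis law : forall A, measurable A -> distribution P (X k0) A = D A.

Lemma joint_law A : measurable A -> joint A = (past \x D)%E A.
Proof.
move=> mA; apply/esym/product_measure_unique => // B C mB mC.
transitivity (P B * distribution P (X k0) C)%E; first exact: past_indep.
by congr (_ * _)%E; exact: law.
Qed.

(** Plays the role of conditioning on all samples but [k0]: [phi] may use these freely through its
    first argument, and they are frozen under the inner integral. *)
Lemma freezing_ge0 (phi : pastType * E k0 -> \bar K) :
  measurable_fun [set: (pastType * E k0)%type] phi -> (forall z, 0 <= phi z)%E ->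
  (\int[P]_w phi (w, X k0 w) = \int[past]_w \int[D]_y phi (w, y))%E.
Proof.
move=> mphi phi0.
rewrite -[LHS](ge0_integral_distribution past_pair)//.
rewrite (eq_measure_integral (past \x D)%E); last first.
  by move=> A mA _; exact: joint_law.
by rewrite fubini_tonelli1.
Qed.

Lemma freezing_le (phi : pastType * E k0 -> \bar K) (c : \bar K) :
  measurable_fun [set: (pastType * E k0)%type] phi -> (forall z, 0 <= phi z)%E ->
  (forall w : pastType, \int[D]_y phi (w, y) <= c)%E ->
  (\int[P]_w phi (w, X k0 w) <= c)%E.
Proof.
move=> mphi phi0 phic; rewrite freezing_ge0//.
have -> : c = (\int[past]_w cst c w)%E.
  have past1 : past setT = 1%E by exact: probability_setT.
  by rewrite integral_cst// [X in (_ * X)%E]past1 mule1.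
apply: ge0_le_integral => //.
- by move=> w _; exact: integral_ge0.
- exact: measurable_fun_fubini_tonelli_F.
Qed.

Lemma freezing_eq0 (phi : pastType * E k0 -> \bar K) :
  measurable_fun [set: (pastType * E k0)%type] phi ->
  P.-integrable setT (fun w => phi (w, X k0 w)) ->
  (forall w : pastType, \int[D]_y phi (w, y) = 0)%E ->
  (\int[P]_w phi (w, X k0 w) = 0)%E.
Proof.
move=> mphi iphi phi0.
rewrite -[LHS](integral_distribution (X := past_pair))//.
rewrite (eq_measure_integral (past \x D)%E); last first.
  by move=> A mA _; exact: joint_law.
rewrite -integral12_prod_meas1; first by apply: integral0_eq => w _; apply: phi0.
(* Fubini needs integrability for the product law; it is carried over from P through the joint
   law. *)
apply/integrableP; split=> //.
rewrite (eq_measure_integral joint); last first.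
  by move=> A mA _; apply/esym/joint_law.
rewrite (ge0_integral_distribution past_pair)//.
  by case/integrableP: iphi.
exact: measurableT_comp.
Qed.

End Law.
End Freezing.

(** * Expectations and measurability *)

Section Expectation.
Context {K : realType} {d : measure_display} {Omega : measurableType d}.
Variable P : probability Omega K.
Implicit Types X Y : Omega -> K.

Definition integ X := P.-integrable setT (EFin \o X).

Definition Ex X : K := \int[P]_w X w.

Lemma ExE X : integ X -> (\int[P]_w (X w)%:E = (Ex X)%:E)%E.
Proof. by move=> iX; rewrite fineK// integrable_fin_num. Qed.

Lemma integD X Y : integ X -> integ Y -> integ (fun w => X w + Y w).
Proof. exact: integrableD. Qed.

Lemma integZ a X : integ X -> integ (fun w => a * X w).
Proof. exact: integrableZl. Qed.

Lemma integB X Y : integ X -> integ Y -> integ (fun w => X w - Y w).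
Proof. exact: integrableB. Qed.

Lemma integ_cst a : integ (fun=> a).
Proof. exact: finite_measure_integrable_cst. Qed.

Lemma integ_sum (I : Type) (s : seq I) (F : I -> Omega -> K) :
  (forall i, integ (F i)) -> integ (fun w => \sum_(i <- s) F i w).
Proof.
move=> iF; elim: s => [|i s IH].
  rewrite (_ : (fun _ => _) = fun=> 0); first exact: integ_cst.
  by apply/funext => w; rewrite big_nil.
rewrite (_ : (fun _ => _) = fun w => F i w + \sum_(j <- s) F j w).
  exact: integD.
by apply/funext => w; rewrite big_cons.
Qed.

Lemma le_integ X Y : measurable_fun setT X -> (forall w, `|X w| <= Y w) ->
  integ Y -> integ X.
Proof.
move=> mX XY; apply: le_integrable => //; first exact/measurable_EFinP.
by move=> w _ /=; rewrite lee_fin (le_trans (XY w))// ler_norm.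
Qed.

Lemma ExD X Y : integ X -> integ Y -> Ex (fun w => X w + Y w) = Ex X + Ex Y.
Proof. exact: RintegralD. Qed.

Lemma ExZ a X : integ X -> Ex (fun w => a * X w) = a * Ex X.
Proof. exact: RintegralZl. Qed.

Lemma ExB X Y : integ X -> integ Y -> Ex (fun w => X w - Y w) = Ex X - Ex Y.
Proof. exact: RintegralB. Qed.

Lemma Ex_cst a : Ex (fun=> a) = a.
Proof.
by rewrite /Ex Rintegral_cst//= probability_setT /= mulr1.
Qed.

Lemma Ex_sum (I : Type) (s : seq I) (F : I -> Omega -> K) :
  (forall i, integ (F i)) ->
  Ex (fun w => \sum_(i <- s) F i w) = \sum_(i <- s) Ex (F i).
Proof.
move=> iF; elim: s => [|i s IH].
  rewrite big_nil -[RHS](Ex_cst 0); congr Ex.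
  by apply/funext => w; rewrite big_nil.
rewrite big_cons -IH -ExD//; last exact: integ_sum.
by congr Ex; apply/funext => w; rewrite big_cons.
Qed.

Lemma le_Ex X Y : integ X -> integ Y -> (forall w, X w <= Y w) -> Ex X <= Ex Y.
Proof. by move=> iX iY XY; apply: le_Rintegral => // w _; apply: XY. Qed.

Lemma Ex_ge0 X : (forall w, 0 <= X w) -> 0 <= Ex X.
Proof. by move=> X0; apply: Rintegral_ge0 => w _. Qed.

Definition L2 X := measurable_fun setT X /\ integ (fun w => X w ^+ 2).

Lemma L2_mul X Y : L2 X -> L2 Y -> integ (fun w => X w * Y w).
Proof.
move=> [mX iX] [mY iY]; apply: (le_integ _ _ (integD iX iY)).
  exact: measurable_funM.
move=> w; rewrite normrM -(real_normK (num_real (X w))).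
rewrite -(real_normK (num_real (Y w))).
have := sqr_ge0 (`|X w| - `|Y w|); have := sqr_ge0 `|X w|.
have := sqr_ge0 `|Y w|; lra.
Qed.

Lemma L2_cst a : L2 (fun=> a).
Proof. by split=> //; apply: integ_cst. Qed.

Lemma L2D X Y : L2 X -> L2 Y -> L2 (fun w => X w + Y w).
Proof.
move=> hX hY; split; first by apply: measurable_funD; [case: hX|case: hY].
rewrite (_ : (fun _ => _) =
   fun w => X w ^+ 2 + (2 * (X w * Y w) + Y w ^+ 2)); last first.
  by apply/funext => w; ring.
apply: integD; first by case: hX.
by apply: integD; [apply: integZ; exact: L2_mul|case: hY].
Qed.

Lemma L2Z a X : L2 X -> L2 (fun w => a * X w).
Proof.
move=> [mX iX]; split; first exact: measurable_funM.
rewrite (_ : (fun _ => _) = fun w => a ^+ 2 * X w ^+ 2); first exact: integZ.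
by apply/funext => w; rewrite exprMn.
Qed.

Lemma L2_sum (I : Type) (s : seq I) (F : I -> Omega -> K) :
  (forall i, L2 (F i)) -> L2 (fun w => \sum_(i <- s) F i w).
Proof.
move=> iF; elim: s => [|i s IH].
  rewrite (_ : (fun _ => _) = fun=> 0); first exact: L2_cst.
  by apply/funext => w; rewrite big_nil.
rewrite (_ : (fun _ => _) = fun w => F i w + \sum_(j <- s) F j w).
  exact: L2D.
by apply/funext => w; rewrite big_cons.
Qed.

Section Matrices.
Context {m k : nat}.
Implicit Types U V : Omega -> 'M[K]_(m, k).

Definition L2mx U := forall i j, L2 (fun w => U w i j).

Lemma L2mx_cst (A : 'M[K]_(m, k)) : L2mx (fun=> A).
Proof. by move=> i j; apply: L2_cst. Qed.

Lemma L2mxD U V : L2mx U -> L2mx V -> L2mx (fun w => U w + V w).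
Proof.
move=> hU hV i j; rewrite (_ : (fun _ => _) = fun w => U w i j + V w i j).
  exact: L2D.
by apply/funext => w; rewrite mxE.
Qed.

Lemma L2mxZ a U : L2mx U -> L2mx (fun w => a *: U w).
Proof.
move=> hU i j; rewrite (_ : (fun _ => _) = fun w => a * U w i j).
  exact: L2Z.
by apply/funext => w; rewrite mxE.
Qed.

Lemma L2mxB U V : L2mx U -> L2mx V -> L2mx (fun w => U w - V w).
Proof.
move=> hU hV; rewrite (_ : (fun _ => _) = fun w => U w + -1 *: V w).
  by apply: L2mxD => //; exact: L2mxZ.
by apply/funext => w; rewrite scaleN1r.
Qed.

Lemma L2mx_dot U V : L2mx U -> L2mx V -> integ (fun w => dot (U w) (V w)).
Proof.
move=> hU hV; apply: integ_sum => i; apply: integ_sum => j; exact: L2_mul.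
Qed.

Lemma L2mx_sq U : L2mx U -> integ (fun w => sq (U w)).
Proof. by move=> hU; apply: L2mx_dot. Qed.

Lemma integ_sq_L2mx U : (forall i j, measurable_fun setT (fun w => U w i j)) ->
  integ (fun w => sq (U w)) -> L2mx U.
Proof.
move=> mU iU i j; split=> //; apply: le_integ iU; first exact: measurable_funX.
by move=> w; rewrite ger0_norm ?sqr_ge0// entry_sq_le.
Qed.

End Matrices.

Lemma L2mxM (m k l : nat) (A : 'M[K]_(m, k)) (U : Omega -> 'M[K]_(k, l)) :
  L2mx U -> L2mx (fun w => A *m U w).
Proof.
move=> hU i j; rewrite (_ : (fun _ => _) = fun w => \sum_r A i r * U w r j).
  by apply: L2_sum => r; apply: L2Z.
by apply/funext => w; rewrite mxE.
Qed.

(** Only the products [A ^+ k *m B] decay, while [A] itself need not contract. So E|A^k V_s|^2 is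
    bounded for all k at once, with a factor th^(2k), by induction on s. *)
Lemma stable_filter_Ex (n p : nat) (A B : 'M[K]_n) (th kap g : K)
    (V U : nat -> Omega -> 'M[K]_(n, p)) (t : nat) :
  0 < th < 1 -> 0 <= kap -> 0 <= g ->
  (forall k, sq (A ^+ k *m B) <= kap * (th ^+ k) ^+ 2) ->
  (forall w, V 0%N w = 0) ->
  (forall s w, V s.+1 w = A *m V s w + B *m U s w) ->
  (forall s, L2mx (U s)) ->
  (forall s, (s < t)%N -> Ex (fun w => sq (U s w)) <= g) ->
  L2mx (V t) /\ Ex (fun w => sq (V t w)) <= kap / (1 - th) ^+ 2 * g.
Proof.
move=> th01 kap0 g0 decay V0 VS L2U; have /andP[th0 th1] := th01.
have L2V s : L2mx (V s).
  elim: s => [|s IH].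
    by rewrite (_ : V 0%N = fun=> 0); [apply: L2mx_cst|apply/funext].
  rewrite (_ : V s.+1 = fun w => A *m V s w + B *m U s w); last exact/funext.
  by apply: L2mxD; apply: L2mxM.
move=> Ug; split=> //.
have th1' : 0 < 1 - th by rewrite subr_gt0.
have Edecay s k : (forall r, (r < s)%N -> Ex (fun w => sq (U r w)) <= g) ->
    Ex (fun w => sq (A ^+ k *m V s w)) <=
    kap / (1 - th) ^+ 2 * g * (th ^+ k) ^+ 2.
  elim: s k => [|s IH] k Ugs.
    rewrite (_ : (fun _ => _) = fun=> 0); last first.
      by apply/funext => w; rewrite V0 mulmx0 sq0.
    rewrite Ex_cst mulr_ge0 ?sqr_ge0// mulr_ge0//.
    by rewrite mulr_ge0 ?invr_ge0 ?sqr_ge0.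
  have iV := L2mx_sq (L2mxM (A ^+ k.+1) (L2V s)).
  have iU := L2mx_sq (L2U s).
  apply: (@le_trans _ _ (Ex (fun w => th^-1 * sq (A ^+ k.+1 *m V s w) +
      (1 - th)^-1 * (kap * (th ^+ k) ^+ 2) * sq (U s w)))).
    apply: le_Ex; first exact/L2mx_sq/L2mxM.
      by apply: integD; apply: integZ.
    move=> w; rewrite VS mulmxDr !mulmxA.
    apply: le_trans (sqD_convex _ _ th01) _; rewrite mulmxE -exprSr lerD2l.
    rewrite -mulrA ler_wpM2l ?invr_ge0 ?(ltW th1')//.
    apply: le_trans (sq_mulmx _ _) _.
    by rewrite ler_wpM2r ?sq_ge0//; apply: decay.
  rewrite ExD; [|exact: integZ|exact: integZ].
  rewrite !ExZ//.
  have IH' := IH k.+1 (fun r rs => Ugs r (ltnW rs)).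
  (* The constant K = kap g / (1 - th)^2 is the fixed point of the recursion: th K + kap g / (1 -
     th) = K. *)
  apply: (@le_trans _ _ (th^-1 * (kap / (1 - th) ^+ 2 * g * (th ^+ k.+1) ^+ 2) +
      (1 - th)^-1 * (kap * (th ^+ k) ^+ 2) * g)).
    apply: lerD; first by rewrite ler_wpM2l ?invr_ge0 ?(ltW th0).
    rewrite ler_wpM2l ?Ugs// mulr_ge0 ?invr_ge0 ?(ltW th1')//.
    by rewrite mulr_ge0 ?sqr_ge0.
  rewrite le_eqVlt; apply/orP; left; apply/eqP; rewrite (exprS th k).
  by field; rewrite subr_eq0 !gt_eqF.
have := Edecay t 0%N Ug; rewrite expr0 expr1n mulr1.
by under eq_fun do rewrite mul1mx.
Qed.

End Expectation.

Section MeasurableRow.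
Context {K : realType} {d : measure_display} {T : measurableType d}.

Lemma measurable_fun_countable (Z : countType) (z : T -> Z) (h : Z -> K) :
  (forall c, measurable (z @^-1` [set c])) ->
  measurable_fun setT (h \o z).
Proof.
move=> mz _ A mA; rewrite setTI.
rewrite (_ : _ @^-1` _ = \bigcup_(c in [set c | A (h c)]) z @^-1` [set c]).
  rewrite bigcup_mkcond; apply: countable_bigcupT_measurable => [|c].
    exact: countableP.
  by case: ifP.
apply/seteqP; split=> [w /= Aw|w [c /= Ac zc]].
  by exists (z w).
by rewrite zc.
Qed.

(* The coordinates are rounded down to the grid of mesh 1 / m, which makes the
   composition with h countably valued. *)
Lemma measurable_fun_continuous_row (p : nat) (h : 'rV[K]_p -> K)
    (x : T -> 'rV[K]_p) :
  continuous h -> (forall j, measurable_fun setT (fun w => x w 0 j)) ->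
  measurable_fun setT (fun w => h (x w)).
Proof.
move=> ch mx.
pose z (m : nat) (w : T) : 'rV[int]_p :=
  \row_j Num.floor (m.+1%:R * x w 0 j).
pose r (m : nat) (c : 'rV[int]_p) : 'rV[K]_p := \row_j ((c 0 j)%:~R / m.+1%:R).
apply: (@measurable_fun_cvg _ _ _ _ (fun m => (h \o r m) \o z m)).
- move=> m; apply: measurable_fun_countable => c.
  rewrite (_ : _ @^-1` _ = \bigcap_(j in [set: 'I_p])
      ((fun w => m.+1%:R * x w 0 j) @^-1`
         [set` `[(c 0 j)%:~R, (c 0 j + 1)%:~R[ ])).
    apply: fin_bigcap_measurable; first exact: finite_finset.
    move=> j _; rewrite -[X in measurable X]setTI.
    have mmx : measurable_fun setT (fun w => m.+1%:R * x w 0 j).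
      exact: measurable_funM.
    exact: mmx.
  apply/seteqP; split=> [w /= <- j _ /=|w /= h1].
    by rewrite in_itv/= mxE floor_itv.
  apply/rowP => j; rewrite mxE; apply: floor_def.
  by have := h1 j I; rewrite /= in_itv.
- move=> w _.
  suff rz : r m (z m w) @[m --> \oo] --> x w by exact: cvg_comp rz (ch (x w)).
  apply/cvgrPdist_le => /= e e0.
  near=> m.
  rewrite /Num.Def.normr/= mx_normrE (bigmax_le _ (ltW e0))//= => -[i j] _.
  rewrite !mxE !ord1/=.
  have /andP[f1 f2] := floor_itv (m.+1%:R * x w 0 j).
  have m0 : 0 < m.+1%:R :> K by rewrite ltr0n.
  have me : m.+1%:R^-1 <= e.
    by near: m; apply: (filterS _ (near_infty_natSinv_lt (PosNum e0))) => m /ltW.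
  apply: le_trans me.
  rewrite ger0_norm; last by rewrite subr_ge0 ler_pdivrMr// [leRHS]mulrC.
  rewrite lerBlDr -[X in _ <= X + _]mul1r -mulrDl ler_pdivlMr// [leLHS]mulrC.
  by rewrite addrC ltW//; move: f2; rewrite intrD.
Unshelve. all: by end_near. Qed.

End MeasurableRow.

(** * Dynamics along a sample path *)

Section PushPullPath.
Context {K : realType} {n p : nat}.
Variables (R C : 'M[K]_n) (piR : 'cV[K]_n) (u : 'rV[K]_n) (eta gamma : K).
Local Notation one := (@Defs.one K n).
Hypothesis R1 : R *m one = one.
Hypothesis piR_R : piR^T *m R = piR^T.
Hypothesis piR_1 : piR^T *m one = 1%:M.
Hypothesis C1 : one^T *m C = one^T.
Hypothesis uC : u *m (1%:M - C) = piR^T - eta *: one^T.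

Variables (x0 : 'rV[K]_p) (X Y G : nat -> 'M[K]_(n, p)).
Hypothesis X0 : X 0%N = one *m x0.
Hypothesis Y0 : Y 0%N = G 0%N.
Hypothesis XS : forall t, X t.+1 = R *m X t - gamma *: (R *m Y t).
Hypothesis YS : forall t, Y t.+1 = C *m (Y t + G t.+1 - G t).

Definition tracking_error (t : nat) : 'M[K]_(n, p) := Y t - G t.

Lemma tracking_error0 : tracking_error 0%N = 0.
Proof. by rewrite /tracking_error Y0 subrr. Qed.

Lemma tracking_errorS t : tracking_error t.+1 =
  C *m tracking_error t + (C - 1%:M) *m G t.+1.
Proof.
rewrite /tracking_error YS mulmxBl mul1mx !mulmxBr mulmxDr.
move: (C *m Y t) (C *m G t) (C *m _) => a b c.
by apply/matrixP => i j; rewrite !mxE; ring.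
Qed.

(** Column stochasticity gives 1^T (C - I) = 0. Consequently 1^T Y_t = 1^T G_t. *)
Lemma one_tracking_error t : one^T *m tracking_error t = 0.
Proof.
elim: t => [|t IH]; first by rewrite tracking_error0 mulmx0.
rewrite tracking_errorS mulmxDr !(mulmxA one^T) (mulmxBr one^T).
rewrite mulmx1 C1 subrr.
by rewrite mul0mx IH addr0.
Qed.

Definition consensus_error (t : nat) : 'M[K]_(n, p) :=
  X t - one *m (piR^T *m X t).

Lemma consensus_error0 : consensus_error 0%N = 0.
Proof. by rewrite /consensus_error X0 (mulmxA piR^T) piR_1 mul1mx subrr. Qed.

Lemma consensus_errorS t : consensus_error t.+1 =
  R *m consensus_error t + (R - one *m piR^T) *m (- gamma *: Y t).
Proof.
rewrite /consensus_error XS !mulmxBr -!scalemxAr !(mulmxA piR^T) piR_R.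
rewrite (mulmxA R one) R1 mulmxBl -mulmxA.
move: (R *m X t) (R *m Y t) (one *m (_ *m Y t)) (one *m _) => a b c e.
by apply/matrixP => i j; rewrite !mxE; ring.
Qed.

(* The average of the iterates corrected by the gradient information that is
   still on its way to the roots: this makes its increments a multiple of the
   plain gradient sum. *)
Definition virtual_iterate (t : nat) : 'rV[K]_p :=
  piR^T *m X t.+1 - gamma *: (u *m (C *m tracking_error t)).

Lemma virtual_iterate0 : virtual_iterate 0%N = x0 - gamma *: (piR^T *m G 0%N).
Proof.
rewrite /virtual_iterate tracking_error0 !mulmx0 scaler0 subr0 XS mulmxBr.
by rewrite -scalemxAr !(mulmxA piR^T) piR_R X0 mulmxA piR_1 mul1mx Y0.
Qed.

Lemma virtual_iterateS t : virtual_iterate t.+1 =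
  virtual_iterate t - (gamma * eta) *: (one^T *m G t.+1).
Proof.
have sY : Y t.+1 = tracking_error t.+1 + G t.+1 by rewrite subrK.
have e1 : one^T *m Y t.+1 = one^T *m G t.+1.
  by rewrite sY mulmxDr one_tracking_error add0r.
have e2 : C *m tracking_error t = tracking_error t.+1 - (C - 1%:M) *m G t.+1.
  by rewrite tracking_errorS addrK.
(* The recursion of the tracking error S gives C S_(t+1) - C S_t = - (I - C) Y_(t+1). The equation
   for [u] then produces the term that cancels pi_R^T Y_(t+1) in the next iterate. *)
have e3 : u *m (C *m tracking_error t.+1) - u *m (C *m tracking_error t) =
    - (piR^T *m Y t.+1) + eta *: (one^T *m G t.+1).
  rewrite -mulmxBr e2.
  transitivity (- (u *m (1%:M - C) *m Y t.+1)).
    rewrite -(mulmxA u) -(mulmxN u); congr (_ *m _).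
    rewrite /tracking_error mulmxBr !mulmxBl !mul1mx.
    move: (C *m Y t.+1) (C *m G t.+1) (Y t.+1) (G t.+1) => a b c e.
    by apply/matrixP => i j; rewrite !mxE; ring.
  by rewrite uC mulmxBl -scalemxAl e1 opprB addrC.
rewrite /virtual_iterate [X t.+2]XS mulmxBr -scalemxAr !(mulmxA piR^T) piR_R.
move: e3 => /(canRL (subrK _)) ->.
move: (piR^T *m X t.+1) (piR^T *m Y t.+1) (one^T *m G t.+1)
  (u *m (C *m _)) => a b c e.
by apply/matrixP => i j; rewrite !mxE; ring.
Qed.

(** * One step of descent along the virtual iterate *)

Section Progress.
Variables (f : 'I_n -> 'rV[K]_p -> K) (L : K).
Hypothesis n0 : (0 < n)%N.
Hypothesis smooth : smoothness_assumption f L.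
Hypothesis eta0 : 0 < eta.
Hypothesis gamma0 : 0 <= gamma.
Hypothesis gamma_small : 8 * L * gamma * eta * n%:R <= 1.

Definition noise (t : nat) : 'M[K]_(n, p) := G t - gradmx f (X t).

Local Notation w := virtual_iterate.

(** The inner products with the noise are kept exactly, since they vanish in expectation; the
    squared noise thus has coefficient [L], without a loss from Young's inequality. *)
Lemma progress t :
  favg f (w t.+1) <= favg f (w t)
    - gamma * eta * n%:R / 2 * sq (grad (favg f) (w t))
    + 2 * eta * L ^+ 2 * gamma * sq (X t.+1 - one *m w t)
    + L * (gamma * eta) ^+ 2 * sq (one^T *m noise t.+1)
    - gamma * eta * dot (grad (favg f) (w t)) (one^T *m noise t.+1)
    + 2 * L * (gamma * eta) ^+ 2 *
      dot (one^T *m gradmx f (X t.+1)) (one^T *m noise t.+1).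
Proof.
have [L0 _ _ _] := smooth.
have nR0 : 0 < n%:R :> K by rewrite ltr0n.
set N := one^T *m noise t.+1; set g := grad (favg f) (w t).
set F := one^T *m gradmx f (X t.+1).
have GE : one^T *m G t.+1 = F + N.
  by rewrite -mulmxDr /noise addrC subrK.
pose e := F - n%:R *: g.
have FE : F = n%:R *: g + e by rewrite /e addrC subrK.
have e2 : sq e <= n%:R * (L ^+ 2 * sq (X t.+1 - one *m w t)).
  rewrite /e /g (grad_favg smooth) scalerA mulfV ?gt_eqF// scale1r -mulmxBr.
  apply: le_trans (sq_mulmx _ _) _; rewrite sq_tr sq_one ler_pM2l//.
  exact: sq_gradmx_lipschitz.
have desc := descent_favg n0 smooth (w t) (w t.+1).
have wE : w t.+1 - w t = - (gamma * eta) *: (F + N).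
  by rewrite virtual_iterateS GE addrC addKr scaleNr.
rewrite wE dotZr sqZ sqrrN dotDr sqD in desc.
have sF : sq F <= 2 * (n%:R ^+ 2 * sq g) + 2 * sq e.
  by rewrite FE -sqZ; apply: sqD_le.
have dF : - dot g F <= - (n%:R * sq g) + n%:R / 4 * sq g + n%:R^-1 * sq e.
  rewrite FE dotDr dotZr -/(sq g) opprD -addrA lerD2l.
  exact: dot_le_sq.
apply: le_trans desc _.
have ge0 : 0 <= gamma * eta by rewrite mulr_ge0// ltW.
set ge := gamma * eta in ge0 *.
have small : L * ge * n%:R <= 8^-1.
  by move: gamma_small; rewrite /ge; lra.
set h := sq g in sF dF *; set E := sq (X t.+1 - _) in e2 *.
have h0 : 0 <= h by apply: sq_ge0.
have se0 : 0 <= sq e by apply: sq_ge0.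
have b1 : ge * - dot g F <= ge * (- (n%:R * h) + n%:R / 4 * h + n%:R^-1 * sq e).
  by rewrite ler_wpM2l.
have b2 : L * ge ^+ 2 * sq F <= L * ge ^+ 2 * (2 * (n%:R ^+ 2 * h) + 2 * sq e).
  by rewrite ler_wpM2l// mulr_ge0 ?sqr_ge0// ltW.
have ne : n%:R^-1 * sq e <= L ^+ 2 * E by rewrite mulrC ler_pdivrMr// mulrC.
(* By [gamma_small] the quadratic term costs a quarter of the decrease; with the quarter lost in
   [dF], half of it remains. *)
have b3 : L * ge ^+ 2 * (2 * (n%:R ^+ 2 * h) + 2 * sq e) <=
    8^-1 * (ge * (2 * n%:R * h + 2 * (n%:R^-1 * sq e))).
  have -> : L * ge ^+ 2 * (2 * (n%:R ^+ 2 * h) + 2 * sq e) =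
     (L * ge * n%:R) * (ge * (2 * n%:R * h + 2 * (n%:R^-1 * sq e))).
    by field; rewrite gt_eqF.
  rewrite ler_wpM2r// mulr_ge0// addr_ge0 ?mulr_ge0 ?invr_ge0// ltW.
have b4 : ge * (n%:R^-1 * sq e) <= ge * (L ^+ 2 * E) by rewrite ler_wpM2l.
have E0 : 0 <= ge * (L ^+ 2 * E) by rewrite mulr_ge0// mulr_ge0 ?sqr_ge0 ?sq_ge0.
have -> : 2 * eta * L ^+ 2 * gamma * E = 2 * (ge * (L ^+ 2 * E)).
  by rewrite /ge; ring.
rewrite -/g; lra.
Qed.

End Progress.
End PushPullPath.

(** * Choice of the stepsize *)

Section Rate.
Context {K : realType}.

(* All the constants a0, ..., a7 are harmless: with gamma of order
   1 / sqrt (T + 1) they only enter at order 1 / (T + 1). *)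
Lemma stepsize_rate
    (nR eta L s2 Delta F00 fmin gam0 a0 a1 a2 a3 a4 a5 a6 a7 q0 : K)
    (F h e v q : K -> nat -> K) :
  0 < nR -> 0 < eta -> 0 < L -> 0 < s2 -> 0 < Delta -> 0 < gam0 ->
  0 <= F00 -> F00 - fmin = Delta ->
  0 <= a0 -> 0 <= a1 -> 0 <= a2 -> 0 <= a3 -> 0 <= a4 -> 0 <= a5 -> 0 <= a6 ->
  0 <= a7 -> 0 <= q0 ->
  (forall gam, 0 < gam <= gam0 ->
    [/\ F gam 0%N <= F00 + a0 * gam,
        forall t, fmin <= F gam t /\ 0 <= h gam t,
        forall t, F gam t.+1 <= F gam t - gam * eta * nR / 2 * h gam t
                    + a1 * gam * e gam t + L * (gam * eta) ^+ 2 * (nR * s2),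
        forall t B, 0 <= B -> (forall s, (s <= t)%N -> v gam s <= B) ->
          e gam t <= a2 * gam ^+ 2 * B
      & [/\ v gam 0%N <= a3,
        forall t, v gam t.+1 <= a4 * F gam t + a5 * e gam t + a6,
        forall t, q gam t.+1 <= 2 * h gam t + a7 * e gam t
      & q gam 0%N <= q0]]) ->
  exists T0 : nat, forall T : nat, (T0 <= T)%N -> exists gam, 0 < gam <= gam0 /\
    T.+1%:R^-1 * \sum_(0 <= t < T.+1) q gam t <=
      9 * Num.sqrt (Delta * s2 * L / (nR * T.+1%:R)).
Proof.
move=> n0 eta0 L0 s20 D0 gam00 F000 FD a00 a10 a20 a30 a40 a50 a60 a70 q00 H.
(* Opaque abbreviations, so that rewriting does not look through them. *)
have [kap kapE] : exists x, x = Delta / (nR * L * eta ^+ 2 * s2) by eexists.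
have kap0 : 0 < kap by rewrite kapE divr_gt0// !mulr_gt0// exprn_gt0.
(* [BF] and [B] are a priori bounds on [F] and on the second moments [v], independent of gamma. The
   summand 1 in each absorbs the contribution of the deviation [e]. *)
have [BF BFE] : exists x, x = F00 + a0 + Delta + 1 by eexists.
have BF0 : 0 <= BF by rewrite BFE; lra.
have [B BE] : exists x, x = a3 + a4 * BF + a6 + 1 by eexists.
have a4BF : 0 <= a4 * BF by rewrite mulr_ge0.
have B0 : 0 <= B by rewrite BE; lra.
have [a8 a8E] : exists x, x = a0 + kap * (a1 * a2 * B) by eexists.
have a8'0 : 0 <= kap * (a1 * a2 * B) by rewrite !mulr_ge0// ltW.
have a80 : 0 <= a8 by rewrite a8E addr_ge0.
have [a9 a9E] : exists x,
    x = (q0 + 4 * a8 / (eta * nR)) / kap + a7 * a2 * B by eexists.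
have a90 : 0 <= a9.
  rewrite a9E addr_ge0 ?divr_ge0 ?addr_ge0 ?mulr_ge0 ?invr_ge0 ?(ltW kap0)//.
  by rewrite mulr_ge0// ltW.
have c0 : 0 < L * eta * s2 by rewrite !mulr_gt0.
(* [Q] dominates every quantity whose product with gamma has to be at most 1; the choice of T0
   guarantees gamma Q <= 1. *)
have [Q QE] : exists x, x = gam0^-1 + 1 + a5 * a2 * B +
    kap * (a1 * a2 * B) + a9 / (L * eta * s2) by eexists.
have Q1 : 0 <= gam0^-1 by rewrite invr_ge0 ltW.
have Q2 : 0 <= a5 * a2 * B by rewrite !mulr_ge0.
have Q3 : 0 <= a9 / (L * eta * s2) by rewrite divr_ge0// ltW.
have Q0 : 0 < Q by rewrite QE; lra.
exists (Num.bound (kap * Q ^+ 2)) => T TT.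
have N0 : 0 < T.+1%:R :> K by rewrite ltr0n.
pose N : K := T.+1%:R.
set s := Num.sqrt _.
have s2E : s ^+ 2 = Delta * s2 * L / (nR * N).
  by rewrite sqr_sqrtr// !mulr_ge0 ?invr_ge0 ?mulr_ge0// ltW.
have s0 : 0 < s by rewrite sqrtr_gt0 divr_gt0 ?mulr_gt0.
have [gam gamE] : exists x, x = s / (L * eta * s2) by eexists.
have g0 : 0 < gam by rewrite gamE divr_gt0.
have gN : gam ^+ 2 * N = kap.
  by rewrite gamE exprMn s2E kapE; field; rewrite !gt_eqF.
have sE : Delta / (gam * eta * nR * N) = s.
  apply: (mulfI (lt0r_neq0 s0)); rewrite -expr2 s2E gamE.
  by field; rewrite !gt_eqF.
have gQ : gam * Q <= 1.
  rewrite -(@expr_le1 _ 2)//; last by rewrite mulr_ge0// ltW.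
  rewrite exprMn -(ler_pM2r N0) mul1r mulrAC gN.
  have := archi_boundP (mulr_ge0 (ltW kap0) (sqr_ge0 Q)).
  move/ltW/le_trans; apply; rewrite ler_nat.
  exact: leq_trans TT (leqnSn T).
have gle x : 0 <= x -> x <= Q -> gam * x <= 1.
  by move=> x0 xQ; apply: le_trans gQ; rewrite ler_pM2l.
have ggam0 : gam <= gam0.
  by rewrite -[leRHS]mul1r -ler_pdivrMr// gle// QE; lra.
have g1 : gam <= 1 by rewrite -[gam]mulr1 gle// QE; lra.
have g2 : gam ^+ 2 * (a5 * a2 * B) <= 1.
  rewrite expr2 -mulrA mulr_ile1 ?mulr_ge0 ?(ltW g0)// gle// QE; lra.
have g3 : gam * (kap * (a1 * a2 * B)) <= 1 by rewrite gle// QE; lra.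
have g4 : gam * a9 <= L * eta * s2.
  by rewrite -[leRHS]mul1r -ler_pdivrMr// -(mulrA gam) gle// QE; lra.
exists gam; split; first by rewrite g0.
have gin : 0 < gam <= gam0 by rewrite g0.
have [F0 FH Fstep eB [v0 vS qS qq0]] := H gam gin.
(* [c2] is the leading noise per step. Over T + 1 steps it adds up to Delta: the stepsize balances
   initial gap and accumulated noise. *)
have [c2 c2E] : exists x, x = L * (gam * eta) ^+ 2 * (nR * s2) by eexists.
have c2N : c2 * N = Delta.
  have -> : c2 * N = L * eta ^+ 2 * nR * s2 * (gam ^+ 2 * N) by rewrite c2E; ring.
  by rewrite gN kapE; field; rewrite !gt_eqF.
have [inc incE] : exists x, x = a1 * gam * (a2 * gam ^+ 2 * B) + c2 by eexists.
have incN : inc * N = gam * (kap * (a1 * a2 * B)) + Delta.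
  rewrite incE mulrDl c2N -gN; congr (_ + _); ring.
have inc0 : 0 <= inc.
  rewrite -(pmulr_lge0 _ N0) incN addr_ge0 ?(ltW D0)//.
  by rewrite mulr_ge0// ltW.
have inv t : (t <= T)%N -> (forall r, (r <= t)%N -> v gam r <= B) /\
    F gam t + gam * eta * nR / 2 * \sum_(0 <= r < t) h gam r <=
    F00 + a0 * gam + t%:R * inc.
  elim: t => [|t IH] tT.
    split; last by rewrite big_geq// mulr0 mul0r !addr0.
    move=> r; rewrite leqn0 => /eqP->; apply: le_trans v0 _.
    by rewrite BE; lra.
  have [vB Fb] := IH (ltnW tT).
  have et := eB t B B0 vB.
  have hs0 : 0 <= gam * eta * nR / 2 * \sum_(0 <= r < t) h gam r.
    rewrite mulr_ge0//; first by rewrite !mulr_ge0// ltW.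
    by apply: sumr_ge0 => r _; case: (FH r).
  have tN : t%:R * inc <= N * inc by rewrite ler_wpM2r// ler_nat ltnW// ltnS ltnW.
  have a0g : a0 * gam <= a0 by rewrite ler_piMr.
  have FBF : F gam t <= BF.
    by rewrite (mulrC N) incN in tN; rewrite BFE; lra.
  split.
    move=> r; rewrite leq_eqVlt => /predU1P[->|]; last by rewrite ltnS; apply: vB.
    apply: le_trans (vS t) _.
    have b1 : a4 * F gam t <= a4 * BF by rewrite ler_wpM2l.
    have b2 : a5 * e gam t <= gam ^+ 2 * (a5 * a2 * B).
      by apply: le_trans (ler_wpM2l a50 et) _; rewrite le_eqVlt; apply/orP; left;
        apply/eqP; ring.
    by rewrite BE; lra.
  rewrite big_nat_recr//= mulrDr.
  have b3 : a1 * gam * e gam t <= a1 * gam * (a2 * gam ^+ 2 * B).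
    by rewrite ler_wpM2l// mulr_ge0// ltW.
  have := Fstep t; rewrite -c2E -[t.+1%:R]natr1 mulrDl mul1r => fs.
  have : inc = a1 * gam * (a2 * gam ^+ 2 * B) + c2 by [].
  move: (Fb) fs b3; clear; lra.
have [vB FT] := inv T (leqnn T).
have eb t : (t <= T)%N -> e gam t <= a2 * gam ^+ 2 * B.
  by move=> tT; apply: eB => // r rt; apply: vB; apply: leq_trans rt tT.
set Sh := \sum_(0 <= r < T) h gam r in FT.
have ShB : gam * eta * nR / 2 * Sh <= 2 * Delta + a8 * gam.
  have tN : T%:R * inc <= N * inc by rewrite ler_wpM2r// ler_nat.
  rewrite (mulrC N) incN in tN.
  have [fT _] := FH T.
  by rewrite a8E; lra.
have Sq : \sum_(0 <= t < T.+1) q gam t <=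
    q0 + 2 * Sh + N * (a7 * (a2 * gam ^+ 2 * B)).
  rewrite big_nat_recl//= -addrA lerD//.
  apply: (@le_trans _ _ (\sum_(0 <= t < T)
      (2 * h gam t + a7 * (a2 * gam ^+ 2 * B)))).
    rewrite !big_mkord; apply: ler_sum => t _; apply: le_trans (qS t) _.
    by rewrite lerD2l ler_wpM2l// eb// ltnW.
  rewrite big_split/= -mulr_sumr lerD2l sumr_const_nat subn0 -mulr_natl.
  rewrite ler_wpM2r ?ler_nat// mulr_ge0// mulr_ge0// mulr_ge0//.
  by rewrite exprn_ge0 ?ltW.
rewrite mulrC ler_pdivrMr//; apply: le_trans Sq _.
have gen0 : 0 < gam * eta * nR by rewrite !mulr_gt0.
(* The 2 Delta of [ShB], initial gap plus noise, becomes 8 [s]; the lower-order terms together cost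
   one more [s] in [last], which makes the 9. *)
have Sh2 : 2 * Sh <= 8 * (s * N) + 4 * a8 / (eta * nR).
  have -> : 8 * (s * N) + 4 * a8 / (eta * nR) =
      4 * (2 * Delta + a8 * gam) / (gam * eta * nR).
    by rewrite -sE; field; rewrite !gt_eqF.
  by rewrite ler_pdivlMr//; lra.
have a9N : a9 * (gam ^+ 2 * N) = q0 + 4 * a8 / (eta * nR) +
    N * (a7 * (a2 * gam ^+ 2 * B)).
  rewrite a9E mulrDl; congr (_ + _); last by ring.
  by rewrite gN divfK// gt_eqF.
have last : a9 * (gam ^+ 2 * N) <= s * N.
  have -> : a9 * (gam ^+ 2 * N) = (gam * a9) / (L * eta * s2) * (s * N).
    by rewrite gamE; field; rewrite !gt_eqF.
  by rewrite ler_piMl ?mulr_ge0 ?(ltW s0)// ler_pdivrMr// mul1r.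
by rewrite -/N; lra.
Qed.

End Rate.

(** * Measurability of the iterates *)

Section MatrixMeasurability.
Context {K : realType} {d : measure_display} {T : measurableType d}.

Definition mx_measurable (m k : nat) (U : T -> 'M[K]_(m, k)) : Prop :=
  forall i j, measurable_fun setT (fun w => U w i j).

Section Algebra.
Context {m k : nat}.
Implicit Types U V : T -> 'M[K]_(m, k).

Lemma mx_measurable_cst (A : 'M[K]_(m, k)) : mx_measurable (fun=> A).
Proof. by move=> i j. Qed.

Lemma mx_measurableD U V : mx_measurable U -> mx_measurable V ->
  mx_measurable (fun w => U w + V w).
Proof.
move=> mU mV i j; under eq_fun do rewrite mxE; exact: measurable_funD.
Qed.

Lemma mx_measurableB U V : mx_measurable U -> mx_measurable V ->
  mx_measurable (fun w => U w - V w).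
Proof.
move=> mU mV i j; under eq_fun do rewrite !mxE; exact: measurable_funB.
Qed.

Lemma mx_measurableZ a U : mx_measurable U ->
  mx_measurable (fun w => a *: U w).
Proof.
move=> mU i j; under eq_fun do rewrite mxE; exact: measurable_funM.
Qed.

Lemma mx_measurable_row U i : mx_measurable U ->
  mx_measurable (fun w => row i (U w)).
Proof. by move=> mU i' j; under eq_fun do rewrite mxE; apply: mU. Qed.

End Algebra.

Lemma mx_measurableM (m k l : nat) (A : 'M[K]_(m, k)) (U : T -> 'M[K]_(k, l)) :
  mx_measurable U -> mx_measurable (fun w => A *m U w).
Proof.
move=> mU i j; under eq_fun do rewrite mxE.
by apply: measurable_sum => r; apply: measurable_funM.
Qed.

Lemma measurable_sq (m k : nat) (U : T -> 'M[K]_(m, k)) :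
  mx_measurable U -> measurable_fun setT (fun w => sq (U w)).
Proof.
move=> mU; apply: measurable_sum => i; apply: measurable_sum => j.
exact: measurable_funM.
Qed.

Section Gradient.
Context {n p : nat} (f : 'I_n -> 'rV[K]_p -> K) (L : K).
Hypothesis n0 : (0 < n)%N.
Hypothesis smooth : smoothness_assumption f L.

Lemma sq_le_norm (v : 'rV[K]_p) : sq v <= p%:R * `|v| ^+ 2.
Proof.
rewrite sqE big_ord1 (@le_trans _ _ (\sum_(j < p) `|v| ^+ 2))//; last first.
  by rewrite sumr_const card_ord mulr_natl.
apply: ler_sum => j _; rewrite -real_normK ?num_real//.
rewrite ler_sqr ?nnegrE// [leRHS]/Num.Def.normr/= mx_normrE.
exact: (le_bigmax _ (fun ij => `|v ij.1 ij.2|) (0, j)).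
Qed.

Lemma continuous_grad (h : 'rV[K]_p -> K) j :
  (forall x y, enorm (grad h x - grad h y) <= L * enorm (x - y)) ->
  continuous (fun x => grad h x 0 j).
Proof.
move=> lip x; have [L0 _ _ _] := smooth.
apply/(@cvgrPdist_le _ _ _ (nbhs x)) => /= e e0.
(* The factor [p] compares squared Euclidean and sup norms; [p.+1] keeps [M] positive when p = 0. *)
pose M := L * (p.+1%:R).
have M0 : 0 < M by rewrite mulr_gt0.
near=> y.
have yx : `|x - y| <= e / M.
  by near: y; apply: cvgr_dist_le => //; rewrite divr_gt0.
rewrite -ler_sqr ?nnegrE ?(ltW e0)// real_normK ?num_real//.
have -> : grad h x 0 j - grad h y 0 j = (grad h x - grad h y) 0 j.
  by rewrite !mxE.
apply: le_trans (entry_sq_le _ _ _) _.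
apply: le_trans (sq_grad_lipschitz L0 lip _ _) _.
apply: (@le_trans _ _ (L ^+ 2 * (p.+1%:R ^+ 2 * (e / M) ^+ 2))).
  rewrite ler_wpM2l ?sqr_ge0//; apply: le_trans (sq_le_norm _) _.
  apply: ler_pM => //.
    by rewrite expr2 -natrM ler_nat; apply: leq_trans (leqnSn p) (leq_pmulr _ _).
  by rewrite ler_sqr ?nnegrE ?(le_trans _ yx).
rewrite -!exprMn le_eqVlt; apply/orP; left; apply/eqP; congr (_ ^+ 2).
by rewrite mulrA -/M mulrC divfK// gt_eqF.
Unshelve. all: by end_near. Qed.

Lemma mx_measurable_gradmx (U : T -> 'M[K]_(n, p)) :
  mx_measurable U -> mx_measurable (fun w => gradmx f (U w)).
Proof.
move=> mU i j; under eq_fun do rewrite mxE.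
apply: (measurable_fun_continuous_row (h := fun x => grad (f i) x 0 j)
  (x := fun w => row i (U w))).
  by apply: continuous_grad => x y; case: smooth.
by move=> k; apply: mx_measurable_row.
Qed.

Lemma mx_measurable_grad_favg (x : T -> 'rV[K]_p) :
  mx_measurable x -> mx_measurable (fun w => grad (favg f) (x w)).
Proof.
move=> mx i j; rewrite ord1.
apply: (measurable_fun_continuous_row (h := fun x => grad (favg f) x 0 j)).
  by apply: continuous_grad; apply: grad_favg_lipschitz.
by move=> k; apply: mx.
Qed.

Lemma measurable_favg (x : T -> 'rV[K]_p) :
  mx_measurable x -> measurable_fun setT (fun w => favg f (x w)).
Proof.
move=> mx; apply: measurable_fun_continuous_row; last by move=> k; apply: mx.
by move=> y; apply: differentiable_continuous; apply: differentiable_favg smooth _.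
Qed.

End Gradient.
End MatrixMeasurability.

Section SppMeasurability.
Context {K : realType} {n p : nat} {dXi : 'I_n -> measure_display}.
Context {Xi : forall i, measurableType (dXi i)}.
Variables (g : forall i, 'rV[K]_p -> Xi i -> 'rV[K]_p).
Arguments g : clear implicits.
Hypothesis mg : jointly_measurable g.
Context {d : measure_display} {T : measurableType d}.

Lemma measurable_stoch_grad_entry i j (x : T -> 'rV[K]_p) (y : T -> Xi i) :
  mx_measurable x -> measurable_fun setT y ->
  measurable_fun setT (fun w => g i (x w) (y w) 0 j).
Proof.
move=> mx my.
pose z w : p.-tuple K * Xi i := ([tuple x w 0 k | k < p], y w).
have mz : measurable_fun setT z.
  apply: measurable_fun_pair => //; apply/measurable_fun_tnthP => k.
  rewrite (_ : _ \o _ = fun w => x w 0 k); first exact: mx.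
  by apply/funext => w /=; rewrite tnth_mktuple.
rewrite (_ : (fun _ => _) =
  (fun z : p.-tuple K * Xi i => g i (\row_k tnth z.1 k) z.2 0 j) \o z).
  by apply: measurableT_comp mz; apply: mg.
apply/funext => w /=; congr (g i _ _ 0 j).
by apply/rowP => k; rewrite mxE tnth_mktuple.
Qed.

Variables (R C : 'M[K]_n) (gamma : K) (x0 : 'rV[K]_p).
Variable s : nat -> forall i, T -> Xi i.

Let path (w : T) (t : nat) (i : 'I_n) := s t i w.
Let X t w := (spp R C gamma g x0 (path w) t).1.
Let Y t w := (spp R C gamma g x0 (path w) t).2.
Let G t w := stoch_grad g (path w t) (X t w).

(** [X t] uses samples before time t only, [Y t] also those of time t. The measurable structure [T]
    is arbitrary, so the lemma serves both for Omega and for the sigma-algebras of the past. *)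
Lemma spp_measurable t :
  ((forall r i, (r < t)%N -> measurable_fun setT (s r i)) ->
    mx_measurable (X t)) /\
  ((forall r i, (r <= t)%N -> measurable_fun setT (s r i)) ->
    mx_measurable (Y t)).
Proof.
have mG r : (forall i, measurable_fun setT (s r i)) -> mx_measurable (X r) ->
    mx_measurable (G r).
  move=> ms mX i j; under eq_fun do rewrite mxE.
  by apply: measurable_stoch_grad_entry => //; apply: mx_measurable_row.
elim: t => [|t [IHX IHY]].
  have mX0 : mx_measurable (X 0%N) by apply: mx_measurable_cst.
  by split=> // ms; apply: (mG 0%N) => // i; apply: ms.
have XS : X t.+1 = fun w => R *m X t w - gamma *: (R *m Y t w).
  by apply/funext => w; rewrite /X /Y /=; case: (spp _ _ _ _ _ _ t).
have YS : Y t.+1 = fun w => C *m (Y t w + G t.+1 w - G t w).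
  by apply/funext => w; rewrite /G /X /Y /=; case: (spp _ _ _ _ _ _ t).
have mXS : (forall r i, (r <= t)%N -> measurable_fun setT (s r i)) ->
    mx_measurable (X t.+1).
  move=> ms; rewrite XS; apply: mx_measurableB.
    by apply: mx_measurableM; apply: IHX => r i rt; apply: ms; apply: ltnW.
  by apply: mx_measurableZ; apply: mx_measurableM; apply: IHY.
split=> // ms; rewrite YS; apply: mx_measurableM.
have ms' r i : (r <= t)%N -> measurable_fun setT (s r i).
  by move=> rt; apply: ms; apply: leqW.
apply: mx_measurableB; first apply: mx_measurableD.
- exact: IHY.
- by apply: mG; [move=> i; apply: ms|apply: mXS].
- apply: mG; first by move=> i; apply: ms'.
  by apply: IHX => r i rt; apply: ms'; apply: ltnW.
Qed.

Lemma stoch_grad_measurable t i j :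
  (forall r i, (r < t)%N -> measurable_fun setT (s r i)) ->
  measurable_fun setT (s t i) ->
  measurable_fun setT (fun w => G t w i j).
Proof.
move=> ms mt; under eq_fun do rewrite mxE.
apply: measurable_stoch_grad_entry => //; apply: mx_measurable_row.
exact: (spp_measurable t).1.
Qed.

End SppMeasurability.

(** * Gradient noise *)

Section Noise.
Context {K : realType} {n p : nat} {dXi : 'I_n -> measure_display}.
Context {Xi : forall i, measurableType (dXi i)}.
Context {D : forall i, probability (Xi i) K}.
Variables (g : forall i, 'rV[K]_p -> Xi i -> 'rV[K]_p).
Arguments g : clear implicits.
Variables (f : 'I_n -> 'rV[K]_p -> K) (L sigma : K).
Context {d : measure_display} {Omega : measurableType d}.
Context {P : probability Omega K}.
Variable xi : nat -> forall i, {RV P >-> Xi i}.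
Hypothesis n0 : (0 < n)%N.
Hypothesis smooth : smoothness_assumption f L.
Hypothesis noisy : noise_assumption D g f sigma.
Hypothesis samp : sampling D xi.
Variables (R C : 'M[K]_n) (gamma : K) (x0 : 'rV[K]_p).

Let path (w : Omega) (t : nat) (i : 'I_n) := xi t i w.
Let X t w := (spp R C gamma g x0 (path w) t).1.
Let G t w := stoch_grad g (path w t) (X t w).
Let W t w := G t w - gradmx f (X t w).

Let samples (k : nat * 'I_n) : {mfun Omega >-> Xi k.2} := xi k.1 k.2.

Local Notation pastType k := (g_sigma_algebraType (cylinders samples k)).

Lemma indep_samples : independent_family P samples.
Proof. by case: samp. Qed.

Lemma sample_law k A : measurable A ->
  distribution P (samples k) A = D k.2 A.
Proof. by case: samp => law _; apply: law. Qed.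

Lemma past_measurable_sample (k : nat * 'I_n) r j : (r, j) != k ->
  measurable_fun [set: pastType k] (xi r j : Omega -> Xi j).
Proof.
move=> rjk _ A mA; rewrite setTI; apply: sub_sigma_algebra.
exact: (preimage_cylinder samples (k := (r, j)) rjk mA).
Qed.

Lemma past_measurable_X t i (m : nat) : (m <= t)%N ->
  @mx_measurable _ _ (pastType (t, i)) _ _ (X m).
Proof.
move=> mt; have [_ mg _ _] := noisy.
apply: (@spp_measurable _ _ _ _ _ _ mg _ (pastType (t, i)) R C gamma x0
  (fun r j => xi r j) m).1.
move=> r j rm; apply: past_measurable_sample.
by apply/eqP => -[rt _]; move: rm; rewrite rt ltnNge mt.
Qed.

(** The past of (t, i) omits the single sample (t, i), so it contains those of the other nodes at
    the same time. *)
Lemma past_measurable_noise t i j c : j != i ->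
  measurable_fun [set: pastType (t, i)] (fun w => W t w j c).
Proof.
move=> ji; have [_ mg _ _] := noisy.
rewrite (_ : (fun _ => _) = fun w => G t w j c - gradmx f (X t w) j c); last first.
  by apply/funext => w; rewrite !mxE.
apply: measurable_funB.
  apply: (@stoch_grad_measurable _ _ _ _ _ _ mg _ (pastType (t, i)) R C gamma x0
    (fun r j => xi r j) t).
    move=> r k rt; apply: past_measurable_sample.
    by apply/eqP => -[rt' _]; move: rt; rewrite rt' ltnn.
  by apply: past_measurable_sample; apply: contraNneq ji => -[->].
apply: (@mx_measurable_gradmx _ _ (pastType (t, i)) _ _ _ _ smooth).
exact: past_measurable_X.
Qed.

Let frozen_noise (t : nat) (i : 'I_n) (z : pastType (t, i) * Xi i) : 'rV[K]_p :=
  g i (row i (X t z.1)) z.2 - grad (f i) (row i (X t z.1)).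

Arguments frozen_noise : clear implicits.

Let frozen_noiseE t i w : frozen_noise t i (w, xi t i w) = row i (W t w).
Proof. by apply/rowP => c; rewrite !mxE. Qed.

Let measurable_frozen_noise t i :
  @mx_measurable _ _ (pastType (t, i) * Xi i)%type _ _ (frozen_noise t i).
Proof.
have [_ mg _ _] := noisy.
have mX1 : @mx_measurable _ _ (pastType (t, i) * Xi i)%type _ _
    (fun z => X t z.1).
  move=> a b; apply: (measurableT_comp (f := fun w : pastType (t, i) => X t w a b)).
    exact: past_measurable_X.
  exact: measurable_fst.
apply: mx_measurableB.
  move=> a c; rewrite ord1; apply: measurable_stoch_grad_entry => //.
  exact: mx_measurable_row.
have := mx_measurable_row i (mx_measurable_gradmx smooth mX1).
by congr mx_measurable; apply/funext => z; rewrite row_gradmx.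
Qed.

(** Stated in the extended reals, because the integrability of the noise is deduced from it. *)
Lemma noise_sq_le t i :
  (\int[P]_w (sq (row i (W t w)))%:E <= (sigma ^+ 2)%:E)%E.
Proof.
have [_ _ _ var] := noisy.
have := @freezing_le _ _ _ _ _ _ _ samples indep_samples (t, i) (D i)
  (sample_law (k := (t, i))) (fun z => (sq (frozen_noise t i z))%:E)
  (sigma ^+ 2)%:E.
under eq_integral do rewrite frozen_noiseE.
apply.
- by apply/measurable_EFinP; apply: measurable_sq.
- by move=> z; rewrite lee_fin sq_ge0.
- move=> w; have := var i (row i (X t w)); rewrite unlock.
  by under eq_integral do rewrite enorm_sq.
Qed.

Lemma measurable_noise t : mx_measurable (W t).
Proof.
have [_ mg _ _] := noisy.
have mxi r j : measurable_fun setT (xi r j : Omega -> Xi j) by [].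
have mX : mx_measurable (X t).
  exact: (@spp_measurable _ _ _ _ _ _ mg _ Omega R C gamma x0
    (fun r j => xi r j) t).1.
apply: mx_measurableB; last exact: mx_measurable_gradmx smooth _ _.
move=> i j.
exact: (@stoch_grad_measurable _ _ _ _ _ _ mg _ Omega R C gamma x0
  (fun r j => xi r j) t).
Qed.

Lemma noise_variance t i : integ P (fun w => sq (row i (W t w))) /\
  Ex P (fun w => sq (row i (W t w))) <= sigma ^+ 2.
Proof.
have iW : integ P (fun w => sq (row i (W t w))).
  apply/integrableP; split.
    apply/measurable_EFinP/measurable_sq/mx_measurable_row.
    exact: measurable_noise.
  apply: (@le_lt_trans _ _ (sigma ^+ 2)%:E); last exact: ltry.
  apply: le_trans (noise_sq_le t i); rewrite le_eqVlt; apply/orP; left.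
  by apply/eqP/eq_integral => w _; rewrite gee0_abs// lee_fin sq_ge0.
by split=> //; rewrite -lee_fin -(ExE iW) noise_sq_le.
Qed.

Lemma L2_noise t : L2mx P (W t).
Proof.
move=> i j; have := integ_sq_L2mx _ (noise_variance t i).1.
move=> /(_ _ 0 j) h; have := h (mx_measurable_row i (measurable_noise t)).
by congr L2; apply/funext => w; rewrite mxE.
Qed.

(** With the past frozen, [H] is a constant factor, and the integral over the fresh sample vanishes
    by unbiasedness. *)
Lemma noise_orthogonal t i c (H : Omega -> K) :
  measurable_fun [set: pastType (t, i)] H -> L2 P H ->
  Ex P (fun w => H w * W t w i c) = 0.
Proof.
move=> mH LH; have [_ _ mean _] := noisy.
pose phi z := (H z.1 * frozen_noise t i z 0 c)%:E.
have phiE w : phi (w, xi t i w) = (H w * W t w i c)%:E.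
  by rewrite /phi frozen_noiseE mxE.
have := @freezing_eq0 _ _ _ _ _ _ _ samples indep_samples (t, i) (D i)
  (sample_law (k := (t, i))) phi.
move=> h; rewrite /Ex /Rintegral (_ : integral _ _ _ = 0)//.
rewrite -(eq_integral _ _ (fun w _ => phiE w)); apply: h.
- apply/measurable_EFinP; apply: measurable_funM.
    have mfst := @measurable_fst _ _ (pastType (t, i)) (Xi i).
    exact: (measurableT_comp mH mfst).
  exact: measurable_frozen_noise.
- rewrite (_ : (fun w => _) = EFin \o (fun w => H w * W t w i c)).
    by apply: L2_mul => //; exact: L2_noise.
  by apply/funext => w /=; rewrite -phiE.
- move=> w; have [iG EG] := mean i (row i (X t w)) c.
  rewrite unlock in EG.
  rewrite /phi/=; under eq_integral do rewrite EFinM.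
  rewrite integralZl//; last first.
    apply: (@eq_integrable _ _ _ _ _ _ (fun y =>
     (g i (row i (X t w)) y 0 c)%:E - (grad (f i) (row i (X t w)) 0 c)%:E)%E) => //.
      by move=> y _; rewrite /frozen_noise !mxE.
    by apply: integrableB => //; exact: finite_measure_integrable_cst.
  suff -> : (\int[D i]_y (frozen_noise t i (w, y) 0 c)%:E = 0)%E by rewrite mule0.
  transitivity (\int[D i]_y ((g i (row i (X t w)) y 0 c)%:E -
      (grad (f i) (row i (X t w)) 0 c)%:E))%E.
    apply: eq_integral => y _; rewrite -EFinB; congr EFin.
    by rewrite /frozen_noise mxE [X in _ + X]mxE.
  have iC : (D i).-integrable setT
      (fun=> (grad (f i) (row i (X t w)) 0 c)%:E).
    exact: finite_measure_integrable_cst.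
  rewrite (integralB measurableT iG iC) EG integral_cst//.
  by rewrite [X in (_ * X)%E]probability_setT mule1 subee.
Qed.

Lemma sq_one_mulE (V : 'M[K]_(n, p)) :
  sq (Defs.one^T *m V) = \sum_c \sum_i \sum_j V i c * V j c.
Proof.
rewrite sqE big_ord1; apply: eq_bigr => c _.
rewrite mxE; under eq_bigr do rewrite !mxE mul1r.
by rewrite expr2 big_distrlr.
Qed.

Lemma dot_one_mulE (v : 'rV[K]_p) (V : 'M[K]_(n, p)) :
  dot v (Defs.one^T *m V) = \sum_c \sum_i v 0 c * V i c.
Proof.
rewrite /dot big_ord1; apply: eq_bigr => c _.
by rewrite mxE mulr_sumr; apply: eq_bigr => i _; rewrite !mxE mul1r.
Qed.

Lemma summed_noise_variance t :
  Ex P (fun w => sq (Defs.one^T *m W t w)) <= n%:R * sigma ^+ 2.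
Proof.
have iWW i j c : integ P (fun w => W t w i c * W t w j c).
  by apply: L2_mul; apply: L2_noise.
under eq_fun do rewrite sq_one_mulE.
rewrite Ex_sum; last by move=> c; apply: integ_sum => i; apply: integ_sum => j.
(* Cross terms between distinct nodes vanish. This leaves n sigma^2, where Cauchy-Schwarz would give
   n^2 sigma^2: the source of the linear speedup. *)
under eq_bigr => c _.
  rewrite Ex_sum; last by move=> i; apply: integ_sum => j.
  under eq_bigr => i _.
    rewrite Ex_sum// (bigD1 i)//= big1 ?addr0; last first.
      move=> j ji; apply: noise_orthogonal; last exact: L2_noise.
      by apply: past_measurable_noise; rewrite eq_sym.
    over.
  over.
rewrite exchange_big/=.
rewrite (@le_trans _ _ (\sum_(i < n) sigma ^+ 2))//; last first.
  by rewrite sumr_const card_ord mulr_natl.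
apply: ler_sum => i _; apply: le_trans (noise_variance t i).2.
rewrite -Ex_sum//; apply: le_Ex.
- exact: integ_sum.
- exact: (noise_variance t i).1.
- move=> w; rewrite sqE big_ord1 le_eqVlt; apply/orP; left; apply/eqP.
  by apply: eq_bigr => c _; rewrite [X in _ = X ^+ 2]mxE expr2.
Qed.

Lemma noise_total_variance t : Ex P (fun w => sq (W t w)) <= n%:R * sigma ^+ 2.
Proof.
under eq_fun do rewrite sq_row.
rewrite Ex_sum; last by move=> i; apply: (noise_variance t i).1.
rewrite (@le_trans _ _ (\sum_(i < n) sigma ^+ 2))//; last first.
  by rewrite sumr_const card_ord mulr_natl.
by apply: ler_sum => i _; apply: (noise_variance t i).2.
Qed.

Lemma noise_dot t (V : Omega -> 'rV[K]_p) : L2mx P V ->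
  (forall i, @mx_measurable _ _ (pastType (t, i)) _ _ V) ->
  Ex P (fun w => dot (V w) (Defs.one^T *m W t w)) = 0.
Proof.
move=> LV mV; under eq_fun do rewrite dot_one_mulE.
have iVW i c : integ P (fun w => V w 0 c * W t w i c).
  by apply: L2_mul; [apply: LV|apply: L2_noise].
rewrite Ex_sum; last by move=> c; apply: integ_sum.
rewrite big1// => c _; rewrite Ex_sum// big1// => i _.
by apply: noise_orthogonal; [apply: mV|apply: LV].
Qed.

Lemma L2_gradmx (U : Omega -> 'M[K]_(n, p)) :
  L2mx P U -> L2mx P (fun w => gradmx f (U w)).
Proof.
move=> LU; have mU i j : measurable_fun setT (fun w => U w i j).
  by case: (LU i j).
have mgU : mx_measurable (fun w => gradmx f (U w)).
  exact: mx_measurable_gradmx smooth _ _.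
apply: integ_sq_L2mx => //.
apply: (@le_integ _ _ _ P _ (fun w => 2 * sq (gradmx f 0) + 2 * L ^+ 2 * sq (U w))).
- exact: measurable_sq.
- move=> w; rewrite ger0_norm ?sq_ge0//.
  apply: le_trans (sq_le_shift _ (gradmx f 0)) _.
  rewrite lerD2l -mulrA ler_pM2l//.
  by have := sq_gradmx_lipschitz smooth (U w) 0; rewrite subr0.
- by apply: integD; [exact: integ_cst|apply: integZ; exact: L2mx_sq].
Qed.

Let Y t w := (spp R C gamma g x0 (path w) t).2.

Lemma spp_XS t w : X t.+1 w = R *m X t w - gamma *: (R *m Y t w).
Proof. by rewrite /X /Y /=; case: (spp _ _ _ _ _ _ t). Qed.

Lemma spp_YS t w : Y t.+1 w = C *m (Y t w + G t.+1 w - G t w).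
Proof. by rewrite /G /X /Y /=; case: (spp _ _ _ _ _ _ t). Qed.

(** The noise variance is bounded whatever the iterate, and the gradients grow linearly; so square
    integrability passes from X_t to G_t. *)
Lemma L2_spp t : [/\ L2mx P (X t), L2mx P (Y t) & L2mx P (G t)].
Proof.
have LG r : L2mx P (X r) -> L2mx P (G r).
  move=> LX; rewrite (_ : G r = fun w => W r w + gradmx f (X r w)).
    by apply: L2mxD; [exact: L2_noise|exact: L2_gradmx].
  by apply/funext => w; rewrite /W subrK.
elim: t => [|t [LX LY LGt]].
  have LX0 : L2mx P (X 0%N) by exact: L2mx_cst.
  by split=> //; exact: LG.
have LXS : L2mx P (X t.+1).
  rewrite (_ : X t.+1 = fun w => R *m X t w - gamma *: (R *m Y t w)).
    by apply: L2mxB; [exact: L2mxM|apply: L2mxZ; exact: L2mxM].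
  by apply/funext => w; rewrite spp_XS.
split=> //; last exact: LG.
rewrite (_ : Y t.+1 = fun w => C *m (Y t w + G t.+1 w - G t w)).
  by apply: L2mxM; apply: L2mxB => //; apply: L2mxD => //; exact: LG.
by apply/funext => w; rewrite spp_YS.
Qed.

Lemma past_measurable_YG t i (m : nat) : (m < t)%N ->
  @mx_measurable _ _ (pastType (t, i)) _ _ (Y m) /\
  @mx_measurable _ _ (pastType (t, i)) _ _ (G m).
Proof.
move=> mt; have [_ mg _ _] := noisy.
have ms r j : (r <= m)%N ->
    measurable_fun [set: pastType (t, i)] (xi r j : Omega -> Xi j).
  move=> rm; apply: past_measurable_sample.
  by apply/eqP => -[rt _]; move: mt; rewrite -rt ltnNge rm.
split.
  exact: (@spp_measurable _ _ _ _ _ _ mg _ (pastType (t, i)) R C gamma x0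
    (fun r j => xi r j) m).2.
move=> a b; apply: (@stoch_grad_measurable _ _ _ _ _ _ mg _ (pastType (t, i))
  R C gamma x0 (fun r j => xi r j) m); last exact: ms.
by move=> r j rm; apply: ms; apply: ltnW.
Qed.

(** * Second moments of the tracking and consensus errors *)

Section Errors.
Variables (piR piC : 'cV[K]_n) (u : 'rV[K]_n) (eta thR kapR thC kapC : K).
Local Notation one := (@Defs.one K n).
Hypothesis R1 : R *m one = one.
Hypothesis piR_R : piR^T *m R = piR^T.
Hypothesis piR_1 : piR^T *m one = 1%:M.
Hypothesis C1 : one^T *m C = one^T.
Hypothesis uC : u *m (1%:M - C) = piR^T - eta *: one^T.
Hypothesis thR01 : 0 < thR < 1.
Hypothesis thC01 : 0 < thC < 1.
Hypothesis kapR0 : 0 <= kapR.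
Hypothesis kapC0 : 0 <= kapC.
Hypothesis decayR : forall t,
  sq (R ^+ t - one *m piR^T) <= kapR * (thR ^+ t) ^+ 2.
Hypothesis decayC : forall t,
  sq (C ^+ t - piC *m one^T) <= kapC * (thC ^+ t) ^+ 2.

Let S t w := tracking_error (Y ^~ w) (G ^~ w) t.
Let V t w := virtual_iterate C piR u gamma (X ^~ w) (Y ^~ w) (G ^~ w) t.

Lemma decay_pow_le (th : K) k : 0 < th < 1 -> (th ^+ k.+1) ^+ 2 <= (th ^+ k) ^+ 2.
Proof.
move=> /andP[th0 th1]; rewrite ler_sqr ?nnegrE ?exprn_ge0 ?(ltW th0)//.
by rewrite exprS ler_piMl ?exprn_ge0 ?(ltW th0)// ltW.
Qed.

(** The limit pi_C 1^T cancels between consecutive powers of [C]. *)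
Lemma decay_tracking k :
  sq (C ^+ k *m (C - 1%:M)) <= 4 * kapC * (thC ^+ k) ^+ 2.
Proof.
have -> : C ^+ k *m (C - 1%:M) =
    (C ^+ k.+1 - piC *m one^T) - (C ^+ k - piC *m one^T).
  rewrite mulmxBr mulmx1 mulmxE -exprSr.
  by apply/matrixP => i j; rewrite !mxE; ring.
apply: le_trans (sqB_le _ _) _.
have h1 := decayC k; have h2 := decayC k.+1.
have h3 := ler_wpM2l kapC0 (decay_pow_le k thC01); lra.
Qed.

Lemma decay_consensus k :
  sq (R ^+ k *m (R - one *m piR^T)) <= kapR * (thR ^+ k) ^+ 2.
Proof.
have Rk1 : R ^+ k *m one = one.
  by elim: k => [|k IH]; rewrite ?expr0 ?mul1mx// exprSr -mulmxA R1.
rewrite mulmxBr mulmxA Rk1 mulmxE -exprSr; apply: le_trans (decayR k.+1) _.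
by rewrite ler_wpM2l// decay_pow_le.
Qed.

Let KS := 4 * kapC / (1 - thC) ^+ 2.
Let KR := kapR / (1 - thR) ^+ 2.

Let KS0 : 0 <= KS.
Proof. by rewrite divr_ge0 ?sqr_ge0// mulr_ge0. Qed.

Let KR0 : 0 <= KR.
Proof. by rewrite divr_ge0 ?sqr_ge0. Qed.

Lemma tracking_bound t B : 0 <= B ->
  (forall s, (s <= t)%N -> Ex P (fun w => sq (G s w)) <= B) ->
  L2mx P (S t) /\ Ex P (fun w => sq (S t w)) <= KS * B.
Proof.
move=> B0 GB.
apply: (@stable_filter_Ex _ _ _ P _ _ C (C - 1%:M) thC (4 * kapC) B S
  (fun s => G s.+1)) => //.
- by rewrite mulr_ge0.
- exact: decay_tracking.
- by move=> w; rewrite /S tracking_error0.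
- move=> s w; rewrite /S; apply: tracking_errorS => r; exact: spp_YS.
- by move=> s; case: (L2_spp s.+1).
- by move=> s st; apply: GB.
Qed.

(** The filter of [R] is driven by gamma Y with Y = S + G, whence gamma^2 and the factor
    [2 * KS + 2]. *)
Lemma consensus_bound t B : 0 <= B ->
  (forall s, (s <= t)%N -> Ex P (fun w => sq (G s w)) <= B) ->
  Ex P (fun w => sq (X t.+1 w - one *m (piR^T *m X t.+1 w))) <=
  KR * (gamma ^+ 2 * ((2 * KS + 2) * B)).
Proof.
move=> B0 GB.
have B1 : 0 <= gamma ^+ 2 * ((2 * KS + 2) * B).
  rewrite mulr_ge0 ?sqr_ge0// mulr_ge0// addr_ge0// mulr_ge0//.
apply: (@stable_filter_Ex _ _ _ P _ _ R (R - one *m piR^T) thR kapR _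
  (fun s w => consensus_error piR (X ^~ w) s)
  (fun s w => - gamma *: Y s w) t.+1 thR01 kapR0 B1 decay_consensus _ _ _ _).2.
- by move=> w; apply: (consensus_error0 piR_1 (x0 := x0)).
- move=> s w.
  apply: (consensus_errorS (X := X ^~ w) (Y := Y ^~ w) R1 piR_R) => r.
  exact: spp_XS.
- by move=> s; apply: L2mxZ; case: (L2_spp s).
- move=> s st; under eq_fun do rewrite sqZ sqrrN.
  have [_ LY LG] := L2_spp s.
  rewrite ExZ; last exact: L2mx_sq.
  rewrite ler_wpM2l ?sqr_ge0//.
  have [LS ES] := @tracking_bound s B B0 (fun r rs => GB r (leq_trans rs st)).
  apply: (@le_trans _ _ (Ex P (fun w => 2 * sq (S s w) + 2 * sq (G s w)))).
    apply: le_Ex; first exact: L2mx_sq.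
      by apply: integD; apply: integZ; apply: L2mx_sq.
    move=> w; rewrite -{1}(subrK (G s w) (Y s w)); exact: sqD_le.
  rewrite ExD ?ExZ; try by [apply: L2mx_sq|apply: integZ; apply: L2mx_sq].
  have := GB s st; move: ES; lra.
Qed.

Lemma L2_virtual t : L2mx P (V t).
Proof.
have [LX _ _] := L2_spp t.+1; have [_ LY LG] := L2_spp t.
apply: L2mxB; first exact: L2mxM.
by apply: L2mxZ; do 2 apply: L2mxM; exact: L2mxB.
Qed.

Lemma L2_deviation t : L2mx P (fun w => X t.+1 w - one *m V t w).
Proof.
have [LX _ _] := L2_spp t.+1.
by apply: L2mxB => //; apply: L2mxM; exact: L2_virtual.
Qed.

Definition deviation_cst : K :=
  2 * (KR * (2 * KS + 2)) + 2 * (n%:R * (sq (u *m C) * KS)).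

Lemma deviation_cst_ge0 : 0 <= deviation_cst.
Proof.
have h : 0 <= 2 * KS + 2 by apply: addr_ge0 => //; apply: mulr_ge0.
apply: addr_ge0; apply: mulr_ge0 => //; apply: mulr_ge0 => //.
by apply: mulr_ge0 => //; apply: sq_ge0.
Qed.

(** The deviation is the consensus error plus the correction gamma 1 u C S_t, also of order gamma^2
    in mean square. *)
Lemma deviation_bound t B : 0 <= B ->
  (forall s, (s <= t)%N -> Ex P (fun w => sq (G s w)) <= B) ->
  Ex P (fun w => sq (X t.+1 w - one *m V t w)) <=
  deviation_cst * gamma ^+ 2 * B.
Proof.
move=> B0 GB; have [LX _ _] := L2_spp t.+1.
have [LS ES] := tracking_bound B0 GB; have EX := consensus_bound B0 GB.
pose c := n%:R * (gamma ^+ 2 * sq (u *m C)).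
have c0 : 0 <= c by rewrite mulr_ge0// mulr_ge0 ?sqr_ge0 ?sq_ge0.
have iD : integ P (fun w => sq (X t.+1 w - one *m (piR^T *m X t.+1 w))).
  by apply/L2mx_sq/L2mxB => //; do 2 apply: L2mxM.
have iS : integ P (fun w => sq (S t w)) by exact: L2mx_sq.
apply: (@le_trans _ _ (Ex P (fun w =>
   2 * sq (X t.+1 w - one *m (piR^T *m X t.+1 w)) + 2 * c * sq (S t w)))).
  apply: le_Ex; first exact/L2mx_sq/L2_deviation.
    by apply: integD; apply: integZ.
  move=> w.
  have -> : X t.+1 w - one *m V t w =
      (X t.+1 w - one *m (piR^T *m X t.+1 w)) +
      one *m (gamma *: (u *m C *m S t w)).
    rewrite /V /virtual_iterate -/(S t w) (mulmxA u) mulmxBr.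
    move: (one *m (piR^T *m _)) (one *m (gamma *: _)) => a b.
    by apply/matrixP => i j; rewrite !mxE; ring.
  apply: le_trans (sqD_le _ _) _; rewrite lerD2l -mulrA ler_pM2l//.
  rewrite sq_one_mul sqZ /c -[leRHS]mulrA ler_wpM2l//.
  rewrite -[leRHS]mulrA ler_wpM2l ?sqr_ge0//.
  exact: sq_mulmx.
rewrite ExD; try exact: integZ.
rewrite !ExZ//.
have := ler_wpM2l c0 ES.
rewrite /deviation_cst /c => h.
move: (Ex P _) (Ex P _) EX h => a b; move: (sq (u *m C)) => q.
by rewrite /deviation_cst; lra.
Qed.

(** * Expected descent and the inequalities that feed the rate *)

Section Estimates.
Hypothesis eta0 : 0 < eta.
Hypothesis gamma0 : 0 <= gamma.
Variable flb : K.
Hypothesis favg_ge : forall x, flb <= favg f x.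
Hypothesis gradmx_le :
  forall x, sq (gradmx f (one *m x)) <= 4 * L * n%:R * (favg f x - flb).

(** The objective is squeezed between [flb] and the quadratic upper bound of the descent lemma at
    0. *)
Lemma integ_favg (x : Omega -> 'rV[K]_p) :
  L2mx P x -> integ P (fun w => favg f (x w)).
Proof.
move=> Lx; have mx : mx_measurable x by move=> i j; case: (Lx i j).
pose M w := favg f 0 + dot (grad (favg f) 0) (x w) + L * sq (x w).
have iM : integ P M.
  apply: integD; last exact/integZ/L2mx_sq.
  apply: integD; first exact: integ_cst.
  by apply: L2mx_dot => //; exact: L2mx_cst.
apply: (@le_integ _ _ _ P _ (fun w => `|flb| + `|M w|)).
- exact: measurable_favg smooth _ _.
- move=> w; have h1 := favg_ge (x w).
  have := descent_favg n0 smooth 0 (x w); rewrite !subr0 -/(M w) => h2.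
  have := ler_norm (M w); have := ler_norm (- M w).
  have := ler_norm flb; have := ler_norm (- flb); rewrite !normrN.
  by rewrite ler_norml; move=> *; apply/andP; split; lra.
- by apply: integD; [exact: integ_cst|exact: integrable_norm].
Qed.

Lemma L2_grad_favg (x : Omega -> 'rV[K]_p) :
  L2mx P x -> L2mx P (fun w => grad (favg f) (x w)).
Proof.
move=> Lx.
rewrite (_ : (fun _ => _) =
    fun w => n%:R^-1 *: (one^T *m gradmx f (one *m x w))).
  by apply/L2mxZ/L2mxM/L2_gradmx/L2mxM.
by apply/funext => w; rewrite (grad_favg smooth).
Qed.

Lemma progress_Ex t : 8 * L * gamma * eta * n%:R <= 1 ->
  Ex P (fun w => favg f (V t.+1 w)) <= Ex P (fun w => favg f (V t w))
    - gamma * eta * n%:R / 2 * Ex P (fun w => sq (grad (favg f) (V t w)))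
    + 2 * eta * L ^+ 2 * gamma * Ex P (fun w => sq (X t.+1 w - one *m V t w))
    + L * (gamma * eta) ^+ 2 * (n%:R * sigma ^+ 2).
Proof.
move=> gsmall; have [L0 _ _ _] := smooth.
have LV r := L2_virtual r.
have LW : L2mx P (fun w => one^T *m W t.+1 w) by apply: L2mxM; exact: L2_noise.
have [LX _ _] := L2_spp t.+1.
have LgV := L2_grad_favg (LV t).
have LF : L2mx P (fun w => one^T *m gradmx f (X t.+1 w)).
  by apply: L2mxM; exact: L2_gradmx.
(* [V t] is built from X_(t+1), Y_t and G_t, thus from samples up to time t, whereas the noise has
   index t + 1. *)
have mV i : @mx_measurable _ _ (pastType (t.+1, i)) _ _ (V t).
  have mX := @past_measurable_X t.+1 i t.+1 (leqnn _).
  have [mY mG] := @past_measurable_YG t.+1 i t (leqnn _).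
  apply: mx_measurableB; first exact: mx_measurableM.
  by apply: mx_measurableZ; do 2 apply: mx_measurableM; exact: mx_measurableB.
have o1 : Ex P (fun w => dot (grad (favg f) (V t w)) (one^T *m W t.+1 w)) = 0.
  by apply: noise_dot => // i; apply: (mx_measurable_grad_favg n0 smooth).
have o2 : Ex P (fun w => dot (one^T *m gradmx f (X t.+1 w))
    (one^T *m W t.+1 w)) = 0.
  apply: noise_dot => // i; apply: mx_measurableM.
  by apply: (mx_measurable_gradmx smooth); exact: past_measurable_X.
have iF r : integ P (fun w => favg f (V r w)) by exact: integ_favg.
have ih := L2mx_sq LgV; have iE := L2mx_sq (L2_deviation t).
have iW := L2mx_sq LW; have i1 := L2mx_dot LgV LW; have i2 := L2mx_dot LF LW.
apply: (@le_trans _ _ (Ex P (fun w => favg f (V t w)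
    - gamma * eta * n%:R / 2 * sq (grad (favg f) (V t w))
    + 2 * eta * L ^+ 2 * gamma * sq (X t.+1 w - one *m V t w)
    + L * (gamma * eta) ^+ 2 * sq (one^T *m W t.+1 w)
    - gamma * eta * dot (grad (favg f) (V t w)) (one^T *m W t.+1 w)
    + 2 * L * (gamma * eta) ^+ 2 *
      dot (one^T *m gradmx f (X t.+1 w)) (one^T *m W t.+1 w)))).
  apply: le_Ex => //.
    apply: integD; last exact: integZ.
    apply: integB; last exact: integZ.
    do 2 (apply: integD; last exact: integZ).
    by apply: integB => //; exact: integZ.
  move=> w; apply: (progress (R := R) (piR := piR)) => //.
  - by move=> r; apply: spp_XS.
  - by move=> r; apply: spp_YS.
have iA : integ P (fun w => favg f (V t w)
    - gamma * eta * n%:R / 2 * sq (grad (favg f) (V t w))).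
  by apply: integB => //; exact: integZ.
have iB : integ P (fun w => favg f (V t w)
    - gamma * eta * n%:R / 2 * sq (grad (favg f) (V t w))
    + 2 * eta * L ^+ 2 * gamma * sq (X t.+1 w - one *m V t w)).
  by apply: integD => //; exact: integZ.
have iC : integ P (fun w => favg f (V t w)
    - gamma * eta * n%:R / 2 * sq (grad (favg f) (V t w))
    + 2 * eta * L ^+ 2 * gamma * sq (X t.+1 w - one *m V t w)
    + L * (gamma * eta) ^+ 2 * sq (one^T *m W t.+1 w)).
  by apply: integD => //; exact: integZ.
rewrite ExD; [|apply: integB => //; exact: integZ|exact: integZ].
rewrite ExB//; last exact: integZ.
rewrite ExD//; last exact: integZ.
rewrite ExD//; last exact: integZ.
rewrite ExB//; last exact: integZ.
rewrite (ExZ _ ih) (ExZ _ iE) (ExZ _ iW) (ExZ _ i1) (ExZ _ i2) o1 o2.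
rewrite !mulr0 subr0 addr0 lerD2l.
rewrite ler_wpM2l ?summed_noise_variance//.
by rewrite mulr_ge0 ?sqr_ge0// ltW.
Qed.

(** The gradients are compared with those at the consensus point 1 w, which the function gap
    controls. The 16 comes from two uses of |a + b|^2 <= 2 |a|^2 + 2 |b|^2 and the 4 of
    [gradmx_le]. *)
Lemma gradient_bound t : Ex P (fun w => sq (G t.+1 w)) <=
  16 * L * n%:R * (Ex P (fun w => favg f (V t w)) - flb)
  + 4 * L ^+ 2 * Ex P (fun w => sq (X t.+1 w - one *m V t w))
  + 2 * (n%:R * sigma ^+ 2).
Proof.
have [LX _ LG] := L2_spp t.+1.
have iF : integ P (fun w => favg f (V t w)) by exact/integ_favg/L2_virtual.
have iE := L2mx_sq (L2_deviation t).
have iW := L2mx_sq (L2_noise t.+1).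
have iFl : integ P (fun w => favg f (V t w) - flb).
  by apply: integB => //; exact: integ_cst.
apply: (@le_trans _ _ (Ex P (fun w => 16 * L * n%:R * (favg f (V t w) - flb)
  + 4 * L ^+ 2 * sq (X t.+1 w - one *m V t w) + 2 * sq (W t.+1 w)))).
  apply: le_Ex; first exact: L2mx_sq.
    by apply: integD; [apply: integD|]; apply: integZ.
  move=> w; have -> : G t.+1 w = gradmx f (X t.+1 w) + W t.+1 w.
    by rewrite addrC subrK.
  have h1 := sqD_le (gradmx f (X t.+1 w)) (W t.+1 w).
  have h2 := sq_le_shift (gradmx f (X t.+1 w)) (gradmx f (one *m V t w)).
  have h3 := sq_gradmx_lipschitz smooth (X t.+1 w) (one *m V t w).
  have h4 := gradmx_le (V t w).
  have aux (a b c q r e F : K) : a <= 2 * b + 2 * c -> b <= 2 * q + 2 * r ->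
      r <= L ^+ 2 * e -> q <= 4 * L * n%:R * F ->
      a <= 16 * L * n%:R * F + 4 * L ^+ 2 * e + 2 * c.
    by lra.
  exact: aux h1 h2 h3 h4.
rewrite ExD; [|apply: integD; exact: integZ|exact: integZ].
rewrite ExD; [|exact: integZ|exact: integZ].
have EB : Ex P (fun w => favg f (V t w) - flb) =
    Ex P (fun w => favg f (V t w)) - flb.
  by have := ExB iF (integ_cst P flb); rewrite Ex_cst.
rewrite (ExZ _ iFl) (ExZ _ iE) (ExZ _ iW) EB lerD2l ler_pM2l//.
exact: noise_total_variance.
Qed.

(** As pi_R sums to 1, pi_R^T (X - 1 w) is the difference of the two averages; so returning from w
    to the iterate of the theorem costs a multiple of the deviation. *)
Lemma stationarity_bound t :
  Ex P (fun w => sq (grad (favg f) (piR^T *m X t.+1 w))) <=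
  2 * Ex P (fun w => sq (grad (favg f) (V t w))) +
  2 * L ^+ 2 * sq piR^T * Ex P (fun w => sq (X t.+1 w - one *m V t w)).
Proof.
have [L0 _ _ _] := smooth; have [LX _ _] := L2_spp t.+1.
have LgV := L2_grad_favg (L2_virtual t).
have iE := L2mx_sq (L2_deviation t).
rewrite -!ExZ//; last exact: L2mx_sq.
rewrite -ExD; try by [exact: integZ|apply: integZ; exact: L2mx_sq].
apply: le_Ex.
- by apply/L2mx_sq/L2_grad_favg/L2mxM.
- by apply: integD; apply: integZ => //; exact: L2mx_sq.
move=> w; apply: le_trans (sq_le_shift _ (grad (favg f) (V t w))) _.
have -> : 2 * L ^+ 2 * sq piR^T * sq (X t.+1 w - one *m V t w) =
    2 * (L ^+ 2 * (sq piR^T * sq (X t.+1 w - one *m V t w))) by ring.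
rewrite lerD2l ler_pM2l//.
apply: le_trans (sq_grad_lipschitz L0 (grad_favg_lipschitz n0 smooth) _ _) _.
rewrite ler_wpM2l ?sqr_ge0//; apply: le_trans (sq_mulmx _ _).
by rewrite mulmxBr (mulmxA piR^T) piR_1 mul1mx.
Qed.

(** The first step moves along pi_R^T G_0 and not along 1^T G_0; it is only shown to raise the
    objective by O(gamma), using gamma^2 <= gamma. *)
Lemma initial_bound : gamma <= 1 ->
  Ex P (fun w => favg f (V 0%N w)) <= favg f x0 + gamma *
    (sq (grad (favg f) x0) + (1 + L) * (sq piR^T * Ex P (fun w => sq (G 0%N w)))).
Proof.
move=> g1; have [L0 _ _ _] := smooth; have [_ _ LG] := L2_spp 0%N.
have iG := L2mx_sq LG.
pose c := gamma * ((1 + L) * sq piR^T).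
apply: (@le_trans _ _ (Ex P (fun w =>
   (favg f x0 + gamma * sq (grad (favg f) x0)) + c * sq (G 0%N w)))).
  apply: le_Ex; first exact/integ_favg/L2_virtual.
    by apply: integD; [exact: integ_cst|exact: integZ].
  move=> w; set a := favg f x0.
  have -> : V 0%N w = x0 - gamma *: (piR^T *m G 0%N w).
    apply: (virtual_iterate0 (R := R)) => // r; exact: spp_XS.
  apply: le_trans (descent_favg n0 smooth x0 _) _.
  rewrite (addrC x0) addrK sqN sqZ dotNr dotZr -/a /c.
  have h1 := dot_le_sq (grad (favg f) x0) (piR^T *m G 0%N w) (@ltr01 K).
  rewrite invr1 mul1r in h1.
  have h2 := sq_mulmx piR^T (G 0%N w).
  have g2 : gamma ^+ 2 <= gamma by rewrite expr2 ler_piMl.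
  have q0 := sq_ge0 (piR^T *m G 0%N w).
  have d0 := sq_ge0 (grad (favg f) x0).
  move: h1 h2 q0 d0; move: (dot _ _) (sq (_ *m _)) (sq (grad _ _)) => dd q e.
  move: (sq piR^T) (sq (G _ _)) => r s h1 h2 q0 d0.
  have k1 : gamma * - dd <= gamma * (e + q) by rewrite ler_wpM2l//; lra.
  have k2 : L * (gamma ^+ 2 * q) <= L * (gamma * q).
    by rewrite ler_pM2l// ler_wpM2r.
  have k3 : gamma * (1 + L) * q <= gamma * (1 + L) * (r * s).
    by rewrite ler_wpM2l// mulr_ge0// addr_ge0// ltW.
  lra.
rewrite ExD; [|exact: integ_cst|exact: integZ].
rewrite Ex_cst ExZ// /c le_eqVlt; apply/orP; left; apply/eqP; ring.
Qed.

End Estimates.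
End Errors.
End Noise.

(** * Linear speedup *)

Lemma spp_stepsize0 (K : realType) (n p : nat) (dXi : 'I_n -> measure_display)
    (Xi : forall i, measurableType (dXi i)) (R C : 'M[K]_n)
    (g : forall i, 'rV[K]_p -> Xi i -> 'rV[K]_p) (x0 : 'rV[K]_p)
    (s : nat -> forall i, Xi i) (t : nat) :
  R *m Defs.one = Defs.one -> (spp R C 0 g x0 s t).1 = Defs.one *m x0.
Proof.
move=> R1; elim: t => //= t; case: (spp _ _ _ _ _ _ t) => X Y /= ->.
by rewrite scale0r subr0 mulmxA R1.
Qed.

Theorem corollary4p2 (K : realType) (c0 : K) :
  exists c1 : K,
  forall (n p : nat) (R C : 'M[K]_n) (piR piC : 'cV[K]_n)
    (f : 'I_n -> 'rV[K]_p -> K) (L sigma : K)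
    (dXi : 'I_n -> measure_display) (Xi : forall i, measurableType (dXi i))
    (D : forall i, probability (Xi i) K)
    (g : forall i, 'rV[K]_p -> Xi i -> 'rV[K]_p)
    (d : measure_display) (Omega : measurableType d)
    (P : probability Omega K) (xi : nat -> forall i, {RV P >-> Xi i})
    (x0 : 'rV[K]_p),
  graphs_assumption R C ->
  weights_assumption R C ->
  root_eigenvector R piR ->
  root_eigenvector C^T piC ->
  noise_assumption D g f sigma ->
  smoothness_assumption f L ->
  sampling D xi ->
  (maxe (M1 piR C) (maxe (M2tilde R piR C) (M1 piR C * M2tilde R piR C))
     / (n%:R * (piR^T *m piC) 0 0 ^+ 2)%:E <= c0%:E)%E ->
  exists T0 : nat, forall T : nat, (T0 <= T)%N ->
  exists gamma : K, 0 <= gamma /\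
    (T.+1%:R^-1%:E *
     \sum_(0 <= t < T.+1)
       'E_P[fun omega =>
         (enorm (grad (favg f)
            (xhat piR R C gamma g x0 (fun s i => xi s i omega) t)) ^+ 2)%R]
     <= (c1 * Num.sqrt ((favg f x0 - inf (range (favg f))) * sigma ^+ 2 * L
                          / (n%:R * T.+1%:R)))%:E)%E.
Proof.
exists 9.
move=> n p R C piR piC f L sigma dXi Xi D g d Omega P xi x0.
move=> [r [rR rC]] [[R0 C0] R1 CT1 expR expC] eigR eigC noisy smooth samp _.
have n0 : (0 < n)%N by apply: leq_ltn_trans (leq0n r) (ltn_ord r).
have nR0 : 0 < n%:R :> K by rewrite ltr0n.
have [L0 _ _ _] := smooth; have [s20 _ _ _] := noisy.
have piR1 := root_eigenvector_sum eigR; have piC1 := root_eigenvector_sum eigC.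
have [piR0 piR_R _ _] := eigR; have [piC0 _ _ _] := eigC.
have C1 : Defs.one^T *m C = Defs.one^T :> 'rV[K]_n.
  by rewrite -[C]trmxK -trmx_mul CT1.
have [thR [kapR [thR01 kapR0 decR]]] := exponential_decay eigR expR.
have [thC [kapC [thC01 kapC0 decCT]]] := exponential_decay eigC expC.
have decC t : sq (C ^+ t - piC *m Defs.one^T) <= kapC * (thC ^+ t) ^+ 2.
  rewrite -sq_tr linearB/= trmx_mul trmxK trmx_pow; exact: decCT.
set eta := (piR^T *m piC) 0 0.
have CT0 : nonneg_mx C^T by move=> i j; rewrite mxE.
(* The common root r contributes a positive term to pi_R^T pi_C. *)
have eta0 : 0 < eta.
  rewrite /eta mxE (bigD1 r)//= mxE ltr_wpDr ?mulr_gt0//.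
  - by apply: sumr_ge0 => k _; rewrite mxE mulr_ge0.
  - exact: root_pos eigR rR.
  - exact: root_pos eigC rC.
(* The right-hand side annihilates pi_C by the choice of eta, since 1^T pi_C = 1. *)
have [u uC] : exists u, u *m (1%:M - C) = piR^T - eta *: Defs.one^T.
  apply: (fixed_space_coker thC01 decC).
  rewrite mulmxBl -scalemxAl -[Defs.one^T *m piC]trmxK trmx_mul trmxK piC1.
  by rewrite trmx1 [piR^T *m piC]mx11_scalar -/eta scalemx1 subrr.
have [flb [favg_lb gradmx_lb]] := sq_gradmx_one_le n0 smooth.
set fmin := inf (range (favg f)).
have fmin_le x : fmin <= favg f x.
  by apply: ge_inf; [exists flb => _ [y _ <-]|exists x].
have Delta0 : 0 <= favg f x0 - fmin by rewrite subr_ge0.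
(* Without initial gap the stepsize formula degenerates to 0, outside the scope of [stepsize_rate].
   Then x0 is a minimiser, and with gamma = 0 all nodes stay there. *)
have := Delta0; rewrite le_eqVlt => /predU1P[D0|Dpos].
  exists 0%N => T _; exists 0; split=> //.
  have g0 : sq (grad (favg f) x0) = 0.
    apply/eqP; rewrite eq_le sq_ge0 andbT.
    by have := sq_grad_favg_le n0 smooth x0 fmin_le; rewrite -D0 mulr0.
  rewrite big1 ?mule0.
    by rewrite lee_fin mulr_ge0 ?sqrtr_ge0.
  move=> t _; rewrite -[RHS](expectation_cst P 0); congr expectation.
  apply/funext => w.
  by rewrite /xhat spp_stepsize0// mulmxA piR1 mul1mx enorm_sq g0.
pose X gam t w := (spp R C gam g x0 (fun s i => xi s i w) t).1.
pose Y gam t w := (spp R C gam g x0 (fun s i => xi s i w) t).2.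
pose G gam t w := stoch_grad g (fun i => xi t i w) (X gam t w).
pose V gam t w := virtual_iterate C piR u gam (X gam ^~ w) (Y gam ^~ w)
  (G gam ^~ w) t.
pose F gam t := Ex P (fun w => favg f (V gam t w)) - flb.
pose h gam t := Ex P (fun w => sq (grad (favg f) (V gam t w))).
pose e gam t := Ex P (fun w => sq (X gam t.+1 w - Defs.one *m V gam t w)).
pose v gam t := Ex P (fun w => sq (G gam t w)).
pose q gam t := Ex P (fun w => sq (grad (favg f) (piR^T *m X gam t w))).
(* G_0 is evaluated at the common starting point, hence does not depend on gamma; this makes [a3]
   uniform. *)
have vE gam : v gam 0%N = v 0 0%N by [].
have LV gam t : L2mx P (V gam t).
  exact: L2_virtual smooth noisy samp R C gam x0 piR u t.
have v00 : 0 <= v 0 0%N by apply: Ex_ge0 => w; apply: sq_ge0.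
(* Ensures both gamma <= 1 and the smallness condition of [progress]. *)
pose gam0 := (1 + 8 * L * eta * n%:R)^-1.
have c80 : 0 <= 8 * L * eta * n%:R by rewrite !mulr_ge0// ltW.
have gam00 : 0 < gam0 by rewrite invr_gt0 ltr_pwDl.
have flb_fmin : flb <= fmin.
  by apply: lb_le_inf; [exists (favg f x0), x0|move=> _ [y _ <-]].
(* [F] is measured from [flb], the level of [gradmx_lb], so its floor is [fmin - flb]; the shift
   drops out of Delta. *)
have rate := @stepsize_rate K n%:R eta L (sigma ^+ 2) (favg f x0 - fmin)
  (favg f x0 - flb) (fmin - flb) gam0
  (sq (grad (favg f) x0) + (1 + L) * (sq piR^T * v 0 0%N))
  (2 * eta * L ^+ 2) (deviation_cst C u thR kapR thC kapC) (v 0 0%N)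
  (16 * L * n%:R) (4 * L ^+ 2) (2 * (n%:R * sigma ^+ 2)) (2 * L ^+ 2 * sq piR^T)
  (sq (grad (favg f) x0)) F h e v q
  nR0 eta0 L0 s20 Dpos gam00.
case: rate.
- by rewrite subr_ge0.
- by rewrite opprB addrA subrK.
- by rewrite addr_ge0 ?sq_ge0// !mulr_ge0 ?sq_ge0// addr_ge0// ltW.
- by rewrite mulr_ge0 ?sqr_ge0// mulr_ge0// ltW.
- exact: deviation_cst_ge0.
- exact: v00.
- by rewrite !mulr_ge0// ltW.
- by rewrite mulr_ge0// sqr_ge0.
- by rewrite mulr_ge0// mulr_ge0// ltW.
- by rewrite mulr_ge0 ?sq_ge0// mulr_ge0// sqr_ge0.
- exact: sq_ge0.
- move=> gam /andP[gam_gt0 gam_le].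
  have gam_ge0 := ltW gam_gt0.
  have gsmall : gam * (1 + 8 * L * eta * n%:R) <= 1.
    by rewrite -ler_pdivlMr ?ltr_pwDl// mul1r.
  have gam1 : gam <= 1.
    by apply: le_trans gsmall; rewrite ler_peMr// lerDl.
  have gam8 : 8 * L * gam * eta * n%:R <= 1.
    apply: le_trans gsmall; rewrite -subr_ge0.
    by rewrite (_ : _ - _ = gam)//; ring.
  split.
  + have := initial_bound n0 smooth noisy samp C x0 u piR_R piR1 gam_ge0
      favg_lb gam1.
    by rewrite /F [X in favg f x0 - flb + X]mulrC addrAC lerD2r.
  + move=> t; split; last by apply: Ex_ge0 => w; apply: sq_ge0.
    rewrite /F lerD2r -(Ex_cst P fmin); apply: le_Ex; first exact: integ_cst.
      exact: (integ_favg n0 smooth favg_lb (LV gam t)).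
    by move=> w; apply: fmin_le.
  + move=> t; have shift (A B k1 k2 k3 : K) : A <= B - k1 + k2 + k3 ->
        A - flb <= B - flb - k1 + k2 + k3.
      by move=> ?; rewrite (addrAC B) (addrAC (B - k1)) (addrAC (B - k1 + k2)) lerD2r.
    exact: (shift _ _ _ _ _ (progress_Ex n0 smooth noisy samp x0 piR_R C1 uC
      eta0 gam_ge0 favg_lb t gam8)).
  + move=> t B B0 vB.
    exact: (deviation_bound smooth noisy samp u R1 piR_R piR1 thR01 thC01 kapR0
      kapC0 decR decC B0 vB).
  split.
  + by rewrite vE.
  + move=> t.
    exact: (gradient_bound n0 smooth noisy samp R C gam x0 piR u favg_lb
      gradmx_lb t).
  + move=> t.
    exact: (stationarity_bound n0 smooth noisy samp R C gam x0 u piR1 t).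
  + rewrite -(Ex_cst P (sq (grad (favg f) x0))) le_eqVlt; apply/orP; left.
    apply/eqP; congr Ex; apply/funext => w.
    by rewrite /X /= mulmxA piR1 mul1mx.
move=> T0 HT; exists T0 => T T0T; have [gam [/andP[gam_gt0 _] rate]] := HT T T0T.
exists gam; split; first exact: ltW.
rewrite (eq_bigr (fun t => (q gam t)%:E)); last first.
  move=> t _; rewrite unlock -ExE; last first.
    apply/L2mx_sq/(L2_grad_favg smooth)/L2mxM.
    by case: (L2_spp smooth noisy samp R C gam x0 t).
  by apply: eq_integral => w _; rewrite enorm_sq.
by rewrite sumEFin -EFinM lee_fin.
Qed.
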